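(* Let $n\ge1$, $k\ge 0$ and $l\ge0$ be integers with $\frac{l}{l+1}<\frac{k}{n}<\frac{l+1}{l+2}$. Then the action of the dihedral group $D_{2n}$ on $H_{2l+1}(\mathcal{N}(n,k))=\mathbb{Z}$ is given by \[g=\mathrm{id},\qquad \varepsilon=(-1)^{l+1}\cdot\mathrm{id}.\]
   Context: All homology has integer coefficients. For integers $i\le j$, $[i,j]_n$ is the image of $\{i,\dots,j\}$ under $\mathbb{Z}\to\mathbb{Z}/n$, and $\mathcal{N}(n,k)$ is the simplicial complex with vertex set $\{0,\dots,n-1\}$ (identified with $\mathbb{Z}/n$) whose maximal simplices are the sets $[i,i+k]_n$, $i=0,\dots,n-1$. The dihedral group $D_{2n}=\langle g,\varepsilon\mid g^n=1,\ \varepsilon^2=1,\ \varepsilon g\varepsilon=g^{-1}\rangle$ acts on $\mathcal{N}(n,k)$ through its action on vertices $g(i)=(i+1)\bmod n$, $\varepsilon(i)=-i\bmod n$, and hence acts on homology. *)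

(* Defs.v *)
From HB Require Import structures.
From mathcomp Require Import all_boot all_order all_fingroup all_algebra.
From mathcomp Require Import all_solvable.
From mathcomp Require Import boolp.

Set Implicit Arguments.
Unset Strict Implicit.
Unset Printing Implicit Defensive.

Import GRing.Theory Quotient.Exports.
Local Open Scope ring_scope.
Local Open Scope quotient_scope.

Record complex (V : finType) := Complex {
  simplices :> {set {set V}};
  simplex_neq0 : set0 \notin simplices;
  simplex_sub : forall s t : {set V},
    s \in simplices -> t \subset s -> t != set0 -> t \in simplices }.

Record simplicial_map (V W : finType) (K : complex V) (L : complex W) :=
  SimplicialMap {
    vertex_map :> V -> W;
    simplicialP : forall s : {set V},
      s \in simplices K -> vertex_map @: s \in simplices L }.

Definition id_simplicial (V : finType) (K : complex V) : simplicial_map K K.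
Proof. by exists id => s; rewrite imset_id. Defined.

Definition comp_simplicial (U V W : finType) (J : complex U) (K : complex V)
  (L : complex W) (f : simplicial_map K L) (g : simplicial_map J K) :
  simplicial_map J L.
Proof.
by exists (f \o g) => s sJ; rewrite imset_comp; do 2!apply: simplicialP.
Defined.

(* An oriented p-chain is an integer-valued function on oriented p-simplices
   that changes sign with the orientation. It is encoded by its values on the
   (p + 1)-tuples of vertices: the tuple x stands for the oriented simplex
   [x_0, ..., x_p], and reordering x by a permutation s multiplies the value
   by the sign of s. Such a function vanishes on tuples with a repeated vertex
   (see [chain_uniq]). The index m of [chain K m] is the number of vertices,
   so that the group of p-chains is [chain K p.+1]; [chain K 0] is trivial. *)

Section Chains.
Variables (V : finType) (K : complex V).

Definition permute_tuple m (s : 'S_m) (x : m.-tuple V) : m.-tuple V :=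
  [tuple tnth x (s i) | i < m].

Definition is_chain m : pred {ffun m.-tuple V -> int} := fun c =>
  [forall x, (c x != 0) ==> ([set v in x] \in simplices K)] &&
  [forall s : 'S_m, forall x, c (permute_tuple s x) == (-1) ^+ s * c x].

Lemma is_chainP m (c : {ffun m.-tuple V -> int}) :
  reflect ((forall x, c x != 0 -> [set v in x] \in simplices K) /\
           (forall (s : 'S_m) x, c (permute_tuple s x) = (-1) ^+ s * c x))
          (is_chain c).
Proof.
apply: (iffP andP) => -[H1 H2]; split.
- by move=> x; apply/implyP; move/forallP: H1; apply.
- by move=> s x; apply/eqP; move/forallP/(_ s)/forallP: H2; apply.
- by apply/forallP => x; apply/implyP/H1.
- by apply/forallP => s; apply/forallP => x; apply/eqP/H2.
Qed.

Fact is_chain_zmod_closed m : zmod_closed (@is_chain m).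
Proof.
split=> [|c d].
  apply/is_chainP; split=> [x|s x]; rewrite !ffunE ?eqxx //.
  by rewrite mulr0.
case/is_chainP=> c1 c2 /is_chainP[d1 d2]; apply/is_chainP.
split=> [x|s x]; rewrite !ffunE ?c2 ?d2 ?mulrBr //.
have [->|/c1//] := eqVneq (c x) 0.
by have [->|/d1//] := eqVneq (d x) 0; rewrite subrr eqxx.
Qed.
HB.instance Definition _ m :=
  GRing.isZmodClosed.Build _ (@is_chain m) (@is_chain_zmod_closed m).

Record chain m := Chain {
  chain_val :> {ffun m.-tuple V -> int}; _ : is_chain chain_val }.
HB.instance Definition _ m := [isSub for @chain_val m].
HB.instance Definition _ m := [Choice of chain m by <:].
HB.instance Definition _ m := [SubChoice_isSubZmodule of chain m by <:].

Lemma chain_supp m (c : chain m) x :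
  c x != 0 -> [set v in x] \in simplices K.
Proof. by case/is_chainP: (valP c) => H _; apply: H. Qed.

Lemma chain_alt m (c : chain m) (s : 'S_m) x :
  c (permute_tuple s x) = (-1) ^+ s * c x.
Proof. by case/is_chainP: (valP c) => _; apply. Qed.

Lemma eq_opp_int0 (z : int) : z = - z -> z = 0.
Proof. by case: z => [[|n]|n]. Qed.

Lemma chain_swap m (c : chain m) (i j : 'I_m) x :
  i != j -> c (permute_tuple (tperm i j) x) = - c x.
Proof. by move=> ij; rewrite chain_alt odd_tperm ij expr1 mulN1r. Qed.

Lemma chain_uniq m (c : chain m) x : c x != 0 -> uniq x.
Proof.
apply: contraNT => /tuple_uniqP nx.
have [i [j [ij xij]]] : exists i j, i != j /\ tnth x i = tnth x j.
  apply: contrapT => H; apply: nx => i j xij; apply: contrapT => ij.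
  by apply: H; exists i, j; split => //; apply/eqP.
apply/eqP/eq_opp_int0; rewrite -(chain_swap c x ij); congr (c _).
apply/eq_from_tnth => k; rewrite tnth_mktuple.
by case: tpermP => [->|->|].
Qed.

(* Since the boundary of [v_0, ..., v_p] is the alternating sum of its faces,
   the coefficient of an oriented simplex [y] in the boundary of c is the sum of
   the values of c on the oriented simplices [v, y]. For y nonempty the test
   below is redundant; for y empty it makes the boundary of a 0-chain zero, so
   that the homology is unreduced. *)
Definition boundary_fun m (c : {ffun m.+1.-tuple V -> int}) :
    {ffun m.-tuple V -> int} :=
  [ffun y : m.-tuple V =>
    if [set v in y] \in simplices K then \sum_(v : V) c [tuple of v :: y]
    else 0].

Lemma permute_cons m (s : 'S_m) v (x : m.-tuple V) :
  permute_tuple (lift_perm ord0 ord0 s) [tuple of v :: x] =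
  [tuple of v :: permute_tuple s x].
Proof.
apply/eq_from_tnth => i; rewrite tnth_mktuple.
case: (unliftP ord0 i) => [j|] ->; last by rewrite lift_perm_id !tnth0.
by rewrite lift_perm_lift !tnthS tnth_mktuple.
Qed.

Lemma set_permute m (s : 'S_m) (x : m.-tuple V) :
  [set v in permute_tuple s x] = [set v in x].
Proof.
apply/setP => v; rewrite !inE; apply/tnthP/tnthP => -[i ->].
  by exists (s i); rewrite tnth_mktuple.
by exists (s^-1%g i); rewrite tnth_mktuple permKV.
Qed.

Fact boundary_subproof m (c : chain m.+1) : is_chain (boundary_fun c).
Proof.
apply/is_chainP; split=> [x|s x]; rewrite !ffunE; first by case: ifP.
rewrite set_permute; case: ifP => _; last by rewrite mulr0.
rewrite big_distrr; apply: eq_bigr => v _.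
by rewrite -permute_cons chain_alt odd_lift_perm.
Qed.

Definition boundary m (c : chain m.+1) : chain m := Chain (boundary_subproof c).

Fact boundary_zmod_morphism m : zmod_morphism (@boundary m).
Proof.
move=> c d; apply/val_inj/ffunP => x; rewrite !ffunE.
case: ifP => _; last by rewrite subr0.
by rewrite -sumrB; apply: eq_bigr => v _; rewrite !ffunE.
Qed.
HB.instance Definition _ m :=
  GRing.isZmodMorphism.Build _ _ (@boundary m) (@boundary_zmod_morphism m).

Lemma boundary_boundary m (c : chain m.+2) : boundary (boundary c) = 0.
Proof.
apply/val_inj/ffunP => x; rewrite !ffunE; case: ifP => // xK.
pose S := \sum_(v : V) \sum_(w : V) c [tuple of w :: [tuple of v :: x]].
transitivity S.
  apply: eq_bigr => v _; rewrite ffunE; case: ifP => // /negbT nK.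
  rewrite big1 // => w _; apply: contraTeq (nK) => /chain_supp wK.
  rewrite negbK; apply: (simplex_sub wK).
    by apply/subsetP => u; rewrite !inE => ->; rewrite orbT.
  by apply/set0Pn; exists v; rewrite !inE eqxx.
apply: eq_opp_int0; rewrite {1}/S exchange_big /S -sumrN.
apply: eq_bigr => v _; rewrite -sumrN; apply: eq_bigr => w _.
have ne : (ord0 : 'I_m.+2) != lift ord0 ord0 by [].
rewrite -(chain_swap c _ ne); congr (c _); apply/eq_from_tnth => i.
rewrite tnth_mktuple; case: (unliftP ord0 i) => [j|] ->; last first.
  by rewrite tpermL tnthS !tnth0.
case: (unliftP ord0 j) => [k|] ->; last by rewrite tpermR tnthS !tnth0.
by rewrite tpermD ?tnthS.
Qed.

Section Homology.
Variable p : nat.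

Definition is_cycle : pred (chain p.+1) := fun c => boundary c == 0.

Fact is_cycle_zmod_closed : zmod_closed is_cycle.
Proof.
split=> [|c d]; rewrite /is_cycle unfold_in; first by rewrite raddf0.
by move=> /eqP cZ /eqP dZ; rewrite unfold_in raddfB /= cZ dZ subrr.
Qed.
HB.instance Definition _ :=
  GRing.isZmodClosed.Build _ is_cycle is_cycle_zmod_closed.

Record cycle := Cycle { cycle_val :> chain p.+1; _ : is_cycle cycle_val }.
HB.instance Definition _ := [isSub for cycle_val].
HB.instance Definition _ := [Choice of cycle by <:].
HB.instance Definition _ := [SubChoice_isSubZmodule of cycle by <:].

Definition is_boundary : pred cycle :=
  fun z => `[< exists b : chain p.+2, boundary b = z >].

Fact is_boundary_zmod_closed : zmod_closed is_boundary.
Proof.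
split=> [|c d]; first by apply/asboolP; exists 0; rewrite raddf0.
move=> /asboolP[a ea] /asboolP[b eb]; apply/asboolP; exists (a - b).
by rewrite raddfB /= ea eb.
Qed.
HB.instance Definition _ :=
  GRing.isZmodClosed.Build _ is_boundary is_boundary_zmod_closed.

Definition homology : Type :=
  Quotient.quot [the zmodClosed cycle of is_boundary : {pred cycle}].
HB.instance Definition _ := GRing.Zmodule.on homology.
HB.instance Definition _ := EqQuotient.on homology.
HB.instance Definition _ := ZmodQuotient.on homology.

End Homology.
End Chains.

Lemma set_tuple_neq0 (T : finType) m (x : m.-tuple T) :
  (0 < m)%N -> [set v in x] != set0.
Proof.
by case: m x => // m x _; apply/set0Pn; exists (thead x); rewrite inE mem_tnth.
Qed.

Lemma set_tuple_eq0 (T : finType) m (x : m.-tuple T) :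
  m = 0%N -> [set v in x] = set0.
Proof.
by move=> m0; apply/setP => u; case: m m0 x => // _ x; rewrite inE tuple0 inE.
Qed.

Section Induced.
Variables (V W : finType) (K : complex V) (L : complex W).
Variable f : simplicial_map K L.

(* The chain map [x_0, ..., x_p] |-> [f x_0, ..., f x_p], where the right-hand
   side is 0 when f is not injective on the vertices; in that case the terms of
   the sum cancel, because c is alternating. *)
Definition push_fun m (c : {ffun m.-tuple V -> int}) :
    {ffun m.-tuple W -> int} :=
  [ffun y : m.-tuple W =>
    \sum_(x : m.-tuple V | [tuple of map f x] == y) c x].

Lemma set_map m (x : m.-tuple V) :
  [set w in [tuple of map f x]] = f @: [set v in x].
Proof.
apply/setP => w; rewrite inE; apply/mapP/imsetP => -[v vx ->];
  by exists v => //; rewrite inE in vx *.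
Qed.

Lemma map_permute m (s : 'S_m) (x : m.-tuple V) :
  [tuple of map f (permute_tuple s x)] =
  permute_tuple s [tuple of map f x].
Proof. by apply/eq_from_tnth => i; rewrite !(tnth_map, tnth_mktuple). Qed.

Lemma permute_tuple_bij (T : finType) m (s : 'S_m) :
  bijective (@permute_tuple T m s).
Proof.
exists (permute_tuple s^-1%g) => x; apply/eq_from_tnth => i;
  by rewrite !tnth_mktuple ?permK ?permKV.
Qed.

Fact push_subproof m (c : chain K m) : is_chain L (push_fun c).
Proof.
apply/is_chainP; split=> [y|s y]; rewrite !ffunE.
  apply: contraNT => yL; rewrite big1 // => x /eqP fx.
  apply: contraNeq yL => /chain_supp xK.
  by rewrite -fx set_map; apply: simplicialP.
rewrite big_distrr (reindex (permute_tuple s)) /=; last first.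
  exact/onW_bij/permute_tuple_bij.
apply: eq_big => x; last by rewrite chain_alt.
by rewrite map_permute (inj_eq (bij_inj (permute_tuple_bij _ s))).
Qed.

Definition push m (c : chain K m) : chain L m := Chain (push_subproof c).

Fact push_zmod_morphism m : zmod_morphism (@push m).
Proof.
move=> c d; apply/val_inj/ffunP => x; rewrite !ffunE -sumrB.
by apply: eq_bigr => y _; rewrite !ffunE.
Qed.
HB.instance Definition _ m :=
  GRing.isZmodMorphism.Build _ _ (@push m) (@push_zmod_morphism m).

Lemma boundary_push m (c : chain K m.+1) :
  boundary (push c) = push (boundary c).
Proof.
apply/val_inj/ffunP => y; rewrite !ffunE.
have E : \sum_(w : W) push c [tuple of w :: y] =
    \sum_(x : m.-tuple V | [tuple of map f x] == y)
      \sum_(v : V) c [tuple of v :: x].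
  under eq_bigr do rewrite ffunE.
  rewrite (exchange_big_dep xpredT) //=.
  rewrite (reindex (fun q : m.-tuple V * V => [tuple of q.2 :: q.1])) /=.
    rewrite [RHS]pair_big_dep /= [RHS]big_mkcond /=; apply: eq_bigr => -[x v] _ /=.
    rewrite andbT; case: ifP => [/eqP xy|xy].
      rewrite (big_pred1 (f v)) // => w /=.
      by rewrite -xy -!val_eqE /= eqseq_cons eqxx andbT eq_sym.
    rewrite big_pred0 // => w; rewrite -val_eqE /= eqseq_cons.
    by rewrite -val_eqE /= in xy; rewrite xy andbF.
  exists (fun t : m.+1.-tuple V => ([tuple of behead t], thead t)) => [[x v]|t] _.
    by congr (_, _); apply/val_inj.
  by case/tupleP: t => v x; apply/val_inj.
have E0 (x : m.-tuple V) : [set v in x] \notin simplices K ->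
    (0 < m)%N -> \sum_(v : V) c [tuple of v :: x] = 0.
  move=> xK m0; rewrite big1 // => v _; apply: contraNeq xK => /chain_supp vK.
  apply: (simplex_sub vK).
    by apply/subsetP => u; rewrite !inE => ->; rewrite orbT.
  exact: set_tuple_neq0.
case: (posnP m) => [m0|m0].
  have empty (T : finType) (J : complex T) (t : m.-tuple T) :
      ([set v in t] \in simplices J) = false.
    by rewrite set_tuple_eq0 //; apply/negbTE/simplex_neq0.
  by rewrite empty big1 // => x _; rewrite ffunE empty.
transitivity (\sum_(w : W) push c [tuple of w :: y]).
  case: ifP => // /negbT yL; rewrite big1 // => w _.
  apply: contraNeq yL => /chain_supp wL; apply: (simplex_sub wL).
    by apply/subsetP => u; rewrite !inE => ->; rewrite orbT.
  exact: set_tuple_neq0.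
rewrite E; apply: eq_bigr => x _; rewrite ffunE.
by case: ifP => // /negbT xK; rewrite E0.
Qed.

Variable p : nat.

Fact push_cycle_subproof (z : cycle K p) : is_cycle (push z).
Proof. by rewrite /is_cycle boundary_push (eqP (valP z)) raddf0. Qed.

Definition push_cycle (z : cycle K p) : cycle L p :=
  Cycle (push_cycle_subproof z).

Definition homology_map (h : homology K p) : homology L p :=
  \pi_(homology L p) (push_cycle (generic_quotient.repr h)).

Fact push_cycle_zmod_morphism : zmod_morphism push_cycle.
Proof. by move=> c d; apply/val_inj; rewrite /= raddfB. Qed.
HB.instance Definition _ :=
  GRing.isZmodMorphism.Build _ _ push_cycle push_cycle_zmod_morphism.

Lemma homology_mapE (z : cycle K p) :
  homology_map (\pi_(homology K p) z) = \pi_(homology L p) (push_cycle z).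
Proof.
rewrite /homology_map; apply/eqP; rewrite -Quotient.idealrBE -raddfB /=.
have : generic_quotient.repr (\pi_(homology K p) z) - z \in @is_boundary _ K p.
  by rewrite Quotient.idealrBE reprK.
move/asboolP=> [b eb]; apply/asboolP; exists (push b).
by rewrite boundary_push eb.
Qed.

Fact homology_map_zmod_morphism : zmod_morphism homology_map.
Proof.
elim/quotW=> x; elim/quotW=> y.
by rewrite -raddfB !homology_mapE !raddfB.
Qed.
HB.instance Definition _ :=
  GRing.isZmodMorphism.Build _ _ homology_map homology_map_zmod_morphism.

End Induced.
Arguments homology_map {V W K L} f {p} h.

Lemma homology_map_id (V : finType) (K : complex V) (f : simplicial_map K K) p :
  f =1 id -> homology_map f (p := p) =1 id.
Proof.
move=> f1; elim/quotW=> z; rewrite homology_mapE; congr (\pi_(homology _ _) _).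
apply/val_inj/val_inj/ffunP => y; rewrite ffunE.
rewrite (eq_bigl (pred1 y)) ?big_pred1_eq // => x.
by congr (_ == _); apply/val_inj; rewrite /= (eq_map f1) map_id.
Qed.

Lemma homology_map_comp (U V W : finType) (J : complex U) (K : complex V)
    (L : complex W) (f : simplicial_map K L) (g : simplicial_map J K)
    (h : simplicial_map J L) p :
  h =1 f \o g ->
  homology_map h (p := p) =1 homology_map f \o homology_map g.
Proof.
move=> hfg; elim/quotW=> z; rewrite /= (homology_mapE g) !homology_mapE.
congr (\pi_(homology _ _) _).
apply/val_inj/val_inj/ffunP => y; rewrite !ffunE.
under [RHS]eq_bigr do rewrite ffunE.
rewrite (exchange_big_dep xpredT) //= [LHS]big_mkcond; apply: eq_bigr => x _.
have -> : ([tuple of map h x] == y) =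
    ([tuple of map f [tuple of map g x]] == y).
  by congr (_ == _); apply/val_inj; rewrite /= -map_comp; apply: eq_map.
case: ifP => H.
  rewrite (big_pred1 [tuple of map g x]) // => t.
  rewrite /= [RHS]eq_sym andbC; case: eqP => // <-; exact: H.
rewrite big_pred0 // => t; apply/negbTE/andP => -[/eqP tH /eqP gH].
by rewrite gH tH eqxx in H.
Qed.

Local Open Scope nat_scope.

(* The image [i, j]_n of {i, ..., j} in Z/n; natural numbers i <= j suffice,
   because every class in Z/n has a representative in {0, ..., n - 1}. *)
Definition cyc_interval (n i j : nat) : {set 'I_n} :=
  [set v : 'I_n | [exists m : 'I_j.+1, (i <= m)%N && (v == m %% n :> nat)]].

Lemma cyc_intervalP (n i j : nat) (v : 'I_n) :
  reflect (exists2 m, (i <= m <= j)%N & v = m %% n :> nat)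
          (v \in cyc_interval n i j).
Proof.
rewrite inE; apply: (iffP existsP) => [[m /andP[im /eqP vm]]|[m /andP[im mj] vm]].
  by exists m => //; rewrite im -ltnS ltn_ord.
by exists (Ordinal (mj : (m < j.+1)%N)); rewrite im vm /=.
Qed.

Definition N_simplices (n k : nat) : {set {set 'I_n}} :=
  [set s : {set 'I_n} |
    (s != set0) && [exists i : 'I_n, s \subset cyc_interval n i (i + k)]].

Fact N_simplex_neq0 n k : set0 \notin N_simplices n k.
Proof. by rewrite inE eqxx. Qed.

Fact N_simplex_sub n k (s t : {set 'I_n}) :
  s \in N_simplices n k -> t \subset s -> t != set0 -> t \in N_simplices n k.
Proof.
rewrite !inE => /andP[_ /existsP[i si]] ts ->; apply/existsP; exists i.
exact: subset_trans si.
Qed.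

Definition N (n k : nat) : complex 'I_n :=
  Complex (@N_simplex_neq0 n k) (@N_simplex_sub n k).

Fact ord_opp_subproof n (i : 'I_n) : ((n - i) %% n < n)%N.
Proof. by rewrite ltn_mod; case: n i => // -[]. Qed.
Definition ord_opp n (i : 'I_n) : 'I_n := Ordinal (ord_opp_subproof i).

Lemma ord_oppK n : involutive (@ord_opp n).
Proof.
move=> i; apply/val_inj => /=; have := ltn_ord i.
have [->|i0 ilt] := posnP i; first by rewrite subn0 modnn subn0 modnn.
by rewrite (modn_small (_ : n - i < n)%N) ?ltn_subrL ?i0 ?(leq_trans _ ilt)//
  subKn ?modn_small // ltnW.
Qed.

Section Dihedral.
  Local Open Scope group_scope.
Variable n : nat.

Definition rot_perm : {perm 'I_n} := perm (@ordS_inj n).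
Definition refl_perm : {perm 'I_n} := perm (inv_inj (@ord_oppK n)).

(* For n >= 3 this permutation group is isomorphic to the dihedral group of
   order 2n, see [dihedral_isog]; for n = 1 or 2 the action of the latter on
   'I_n is not faithful and this is its image. *)
Definition dihedral : {group {perm 'I_n}} := <<[set rot_perm; refl_perm]>>.

Lemma rot_perm_in : rot_perm \in dihedral.
Proof. by rewrite mem_gen // !inE eqxx. Qed.

Lemma refl_perm_in : refl_perm \in dihedral.
Proof. by rewrite mem_gen // !inE eqxx orbT. Qed.

Definition dihedral_g : [subg dihedral] := Subg rot_perm_in.
Definition dihedral_eps : [subg dihedral] := Subg refl_perm_in.

Lemma rot_permX m (i : 'I_n) : (rot_perm ^+ m) i = (i + m) %% n :> nat.
Proof.
elim: m => [|m IH]; first by rewrite expg0 perm1 addn0 modn_small.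
by rewrite expgSr permM permE /= IH addnS -addn1 modnDml addn1.
Qed.

Lemma rot_perm_expn : rot_perm ^+ n = 1.
Proof.
apply/permP => i; apply/val_inj; rewrite /= rot_permX perm1 modnDr.
by rewrite modn_small.
Qed.

Lemma refl_perm_expn : refl_perm ^+ 2 = 1.
Proof. by apply/permP => i; rewrite expgS expg1 permM perm1 !permE ord_oppK. Qed.

Lemma refl_rot_refl : refl_perm * rot_perm * refl_perm = rot_perm^-1.
Proof.
apply/eqP; rewrite eq_sym eq_invg_mul; apply/eqP/permP => i.
rewrite !permM perm1 !permE; apply/val_inj => /=.
have := ltn_ord i; rewrite leq_eqVlt => /orP[/eqP iE|lt].
  rewrite iE modnn subn0 modnn.
  case: (ltnP 1 n) => n1; last first.
    by move: iE n1; case: (i : nat) => [|?] <-.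
  have n0 : (0 < n)%N by apply: ltnW.
  apply: succn_inj; rewrite iE (modn_small n1) modn_small ?ltn_subrL ?n0 //.
  by rewrite subn1 prednK.
rewrite (modn_small lt) (modn_small (_ : n - i.+1 < n)%N); last first.
  by rewrite ltn_subrL (leq_trans _ lt).
rewrite subnSK; last exact: ltnW.
exact: (congr1 val (ord_oppK i)).
Qed.

Lemma order_rot_perm : (0 < n)%N -> #[rot_perm] = n.
Proof.
move=> n0; apply/eqP; rewrite eqn_dvd order_dvdn rot_perm_expn eqxx /=.
have := rot_permX #[rot_perm] (Ordinal n0).
by rewrite expg_order perm1 /= add0n => /esym/eqP.
Qed.

Lemma dihedral_isog : (2 < n)%N -> dihedral \isog 'D_n.*2.
Proof.
move=> n2; have n1 : (1 < n)%N by apply: ltnW.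
have n0 : (0 < n)%N by apply: ltnW.
have rI : refl_perm^-1 = refl_perm.
  by apply/eqP; rewrite eq_invg_mul -expg2 refl_perm_expn.
have rotJ : rot_perm ^ refl_perm = rot_perm^-1.
  by rewrite conjgE rI mulgA refl_rot_refl.
rewrite isogEcard card_dihedral //; apply/andP; split.
  rewrite Grp_dihedral //; apply/existsP; exists (rot_perm, refl_perm).
  rewrite /= !xpair_eqE rot_perm_expn refl_perm_expn rotJ !eqxx !andbT.
  by rewrite joing_idl joing_idr.
have sub : <[rot_perm]> \subset dihedral by rewrite cycle_subG rot_perm_in.
have pr : <[rot_perm]> \proper dihedral.
  rewrite properE sub; apply/subsetPn; exists refl_perm; first exact: refl_perm_in.
  apply/negP => /cycleP[m rE].
  have : rot_perm ^ refl_perm = rot_perm.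
    by apply/conjg_fixP/commgP; rewrite rE; apply: commuteX.
  rewrite rotJ => /eqP; rewrite eq_invg_mul -expg2 -order_dvdn order_rot_perm //.
  by move=> /dvdn_leq-/(_ isT); rewrite leqNgt n2.
have := cardSg sub; have := proper_card pr.
rewrite -orderE order_rot_perm // => lt /dvdnP[q qE].
move: lt; rewrite qE -mul2n leq_mul2r -{1}[n]mul1n ltn_mul2r.
by move=> /andP[_ ->]; rewrite orbT.
Qed.

End Dihedral.

Fact rot_simplicial n k (s : {set 'I_n}) :
  s \in N_simplices n k -> rot_perm n @: s \in N_simplices n k.
Proof.
rewrite !inE => /andP[s0 /existsP[i /subsetP si]].
rewrite imset_eq0 s0; apply/existsP; exists (ordS i).
apply/subsetP => _ /imsetP[v /si/cyc_intervalP[m /andP[im mi] vm] ->].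
apply/cyc_intervalP; exists ((i.+1 %% n) + (m - i))%N.
  by rewrite leq_addr leq_add2l leq_subLR.
by rewrite permE /= modnDml addSn subnKC // vm -addn1 modnDml addn1.
Qed.

Lemma modn_oppD n m : 0 < n -> (n - m %% n + m) %% n = 0.
Proof.
by move=> n0; rewrite -modnDmr subnK ?modnn // ltnW // ltn_mod.
Qed.

Fact refl_simplicial n k (s : {set 'I_n}) :
  s \in N_simplices n k -> refl_perm n @: s \in N_simplices n k.
Proof.
rewrite !inE => /andP[s0 /existsP[i /subsetP si]].
have n0 : 0 < n by case: n i {s s0 si} => // -[].
pose j := (n - (i + k) %% n) %% n.
have jn : j < n by rewrite ltn_mod.
rewrite imset_eq0 s0; apply/existsP; exists (Ordinal jn).
apply/subsetP => _ /imsetP[v /si/cyc_intervalP[m /andP[im mi] vm] ->].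
apply/cyc_intervalP; exists (j + (i + k - m)).
  by rewrite leq_addr /= leq_add2l leq_subLR leq_add2r.
rewrite permE /= vm; apply/eqP; rewrite -(eqn_modDr m) modn_oppD //.
by rewrite -addnA subnK // modnDml modn_oppD.
Qed.

Fact dihedral_simplicial n k (x : {perm 'I_n}) : x \in dihedral n ->
  forall s : {set 'I_n}, s \in N_simplices n k -> x @: s \in N_simplices n k.
Proof.
suff /subsetP H : dihedral n \subset 'N(N_simplices n k | 'P^*)%g.
  move=> /H xN s sN.
  by rewrite -(astabs_act s xN) /= in sN.
rewrite gen_subG subUset !sub1set.
by apply/andP; split; rewrite !inE /=; apply/subsetP => s sN; rewrite inE /=;
  [apply: rot_simplicial | apply: refl_simplicial].
Qed.

Definition dihedral_map n k (x : [subg dihedral n]) :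
    simplicial_map (N n k) (N n k) :=
  @SimplicialMap _ _ (N n k) (N n k) (sgval x)
    (@dihedral_simplicial n k (sgval x) (subgP x)).

(* MathComp composes permutations from left to right, hence the order of the
   factors in [dihedral_actM]. *)
Definition dihedral_act n k p (x : [subg dihedral n]) :
    homology (N n k) p -> homology (N n k) p :=
  homology_map (dihedral_map k x).

Lemma dihedral_act1 n k p : @dihedral_act n k p 1%g =1 id.
Proof. by apply: homology_map_id => i /=; rewrite perm1. Qed.

Lemma dihedral_actM n k p (x y : [subg dihedral n]) :
  @dihedral_act n k p (x * y)%g =1 dihedral_act y \o dihedral_act x.
Proof. by apply: homology_map_comp => i /=; rewrite permM. Qed.

(* Main.v *)
Require Import Defs.
From HB Require Import structures.
From mathcomp Require Import all_boot all_order all_fingroup all_algebra.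
From mathcomp Require Import boolp zify ring.

(** Write m = n - k and q = l + 1. The two inequalities say that
    q m < n < (q + 1) m, and a nonempty set of vertices is a face exactly when
    m - 1 cyclically consecutive vertices avoid it, that is, when one of its
    cyclic gaps is at least m.

    Using the order of 0, ..., n - 1, a chain becomes an integer function on
    sets of vertices, so that chains of the full simplex form the exterior
    algebra on symbols e_v; the boundary [bd] is the antiderivation sending each
    e_v to 1, and [bd_wedge] is the resulting homotopy formula.

    A class on which the action is visible. The 2-form
    omega = sum_v e_v /\ e_(v+1) has boundary sum_v (e_(v+1) - e_v) = 0, so
    omega^q is a cycle of dimension 2 q - 1 = 2 l + 1. The rotation fixes omega
    and the reflection changes its sign, so they act on omega^q by 1 and by
    (-1)^q. The simplices of omega^q are unions of q pairs of neighbours; each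
    pair meets only m of the n cyclic runs of m - 1 vertices and q m < n, so
    some run avoids the whole set and the simplex is a face
    ([cyclic_polytope_face]). Geometrically omega^q is q! times the
    fundamental cycle of the boundary of a cyclic polytope.

    A functional that detects it. On increasing sequences let
    jump x y = [y - x >= m]. The q-th cup power of the coboundary of jump is a
    cocycle of the full simplex ([alt_sum_cup_power]). It vanishes on faces:
    where it is nonzero the span of the sequence is at least q m, and a further
    gap of size m would force n >= (q + 1) m ([cup_power_face]). Hence pairing
    it with the cone 0 * z over a cycle z gives a functional on homology, the
    winding number. It is positive on omega^q, since all the terms are
    nonnegative and one of them is not zero ([winding_polytope_gt0]).

    The winding number is injective. A cycle z is the boundary of the cone
    c = 0 * z in the full simplex; if its winding number is zero, c can be
    modified so as to avoid the sets that are not faces. These sets are matched in pairs that differ by one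
    element, as in discrete Morse theory. Sets of size 2 q + 1 matched with a
    larger set are removed from c by adding boundaries
    ([eliminate_matched_up]); the only unmatched set of that size then
    has a coefficient equal to the winding number; the coefficients of the
    others vanish because the boundary of c does not involve their smaller
    partners ([winding_exact]).

    So the homology embeds in the integers with nonzero image. It is therefore
    isomorphic to the integers, and an endomorphism acts on all of it by the
    factor by which it acts on the class of omega^q ([rank1_endo]). *)

Set Implicit Arguments.
Unset Strict Implicit.
Unset Printing Implicit Defensive.

Import GRing.Theory Num.Theory.
Local Open Scope ring_scope.
Local Open Scope quotient_scope.

(** * Chains as functions on sets: boundary and exterior multiplication *)

Section SetChains.
Variable n : nat.
Local Notation V := 'I_n.
Implicit Types (A B : {set V}) (u v w : V) (f : {set V} -> int).

(** The sign needed to move v from the front to its place in increasing order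
    among the elements of A. *)
Definition pos_sign v A : int := (-1) ^+ #|[set u in A | (u < v)%N]|.

(** The boundary in terms of increasingly ordered simplices: contraction with the
    linear form sending every e_v to 1. *)
Definition bd f B : int := \sum_(v | v \notin B) pos_sign v B * f (v |: B).

(** Exterior multiplication by e_v on the left, that is, the cone with apex v. *)
Definition wedge v f A : int :=
  if v \in A then pos_sign v (A :\ v) * f (A :\ v) else 0.

Lemma pos_signK v A x : pos_sign v A * (pos_sign v A * x) = x.
Proof. by rewrite mulrA -expr2 sqrr_sign mul1r. Qed.

Lemma pos_signU1 v w A :
  w \notin A -> pos_sign v (w |: A) = (-1) ^+ (w < v)%N * pos_sign v A.
Proof.
move=> wA; rewrite /pos_sign -exprD; congr (_ ^+ _).
rewrite -[LHS]sum1_card [LHS](bigID (pred1 w)) /=; congr addn.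
  case wv: (w < v)%N.
    by rewrite (big_pred1 w) // => u; rewrite !inE; case: eqVneq => [->|];
      rewrite ?andbF ?wv.
  by rewrite big_pred0 // => u; rewrite !inE; case: eqVneq => [->|];
      rewrite ?andbF ?wv.
rewrite -sum1_card; apply: eq_bigl => u; rewrite !inE.
by case: eqVneq => [->|_] /=; rewrite ?(negbTE wA) ?andbF ?andbT.
Qed.

Lemma pos_signD1 v w A :
  w \in A -> pos_sign v A = (-1) ^+ (w < v)%N * pos_sign v (A :\ w).
Proof. by move=> wA; rewrite -{1}(setD1K wA) pos_signU1 // !inE eqxx. Qed.

Lemma ltn_sign_anti v w :
  v != w -> (-1) ^+ (v < w)%N * (-1) ^+ (w < v)%N = -1 :> int.
Proof. by rewrite neq_ltn => /orP[]vw; rewrite vw ltnNge ltnW. Qed.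

(** The boundary is an antiderivation and maps e_v to 1. This one identity gives
    both the contractibility of the full simplex (v is the apex of a cone) and the
    closedness of the 2-form [omega]. *)
Lemma bd_wedge v f A : bd (wedge v f) A = f A - wedge v (bd f) A.
Proof.
rewrite /bd /wedge; have [vA|vA] := boolP (v \in A); last first.
  rewrite subr0 (bigD1 v) //= setU11 setU1K // pos_signK big1 ?addr0 // => u.
  by case/andP=> _ uv; rewrite !inE (negbTE vA) orbF eq_sym (negbTE uv) mulr0.
rewrite [in RHS](bigD1 v) /= ?inE ?eqxx // setD1K // mulrDr pos_signK.
rewrite opprD addrA subrr add0r mulr_sumr -sumrN; apply: eq_big => u.
  rewrite !inE; case: eqVneq => [->|] //=; last by rewrite andbT.
  by rewrite vA.
move=> uA; have uv : u != v by apply: contraNneq uA => ->.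
rewrite !inE vA orbT.
have -> : (u |: A) :\ v = u |: (A :\ v).
  apply/setP => w; rewrite !inE.
  by case: eqVneq => [->|] //=; rewrite eq_sym (negbTE uv).
rewrite (pos_signD1 u vA) pos_signU1; last by rewrite !inE negb_and uA orbT.
have := ltn_sign_anti uv; set a := _ ^+ _; set b := _ ^+ _ => ab.
transitivity ((a * b) * (pos_sign v (A :\ v) * (pos_sign u (A :\ v) * f (u |: A :\ v)))).
  by ring.
by rewrite ab mulN1r.
Qed.

Lemma wedge_anti v w f A : wedge v (wedge w f) A = - wedge w (wedge v f) A.
Proof.
rewrite /wedge !inE; have [->|vw] /= := eqVneq v w; first by rewrite mulr0 if_same oppr0.
rewrite ?[w == v]eq_sym ?vw ?(negbTE vw) /=.
case vA: (v \in A); case wA: (w \in A); rewrite ?mulr0 ?oppr0 //.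
have -> : (A :\ w) :\ v = (A :\ v) :\ w by apply/setP=> u; rewrite !inE andbCA.
rewrite (@pos_signD1 v w (A :\ v)); last by rewrite !inE eq_sym vw wA.
rewrite (@pos_signD1 w v (A :\ w)); last by rewrite !inE vw vA.
have -> : (A :\ w) :\ v = (A :\ v) :\ w by apply/setP=> u; rewrite !inE andbCA.
have := ltn_sign_anti vw; set a := _ ^+ _; set b := _ ^+ _ => ab.
set p := pos_sign _ _; set q := pos_sign _ _; set x := f _.
have bb : b * b = 1 by rewrite -expr2 sqrr_sign.
have -> : a = - b by rewrite -[a]mulr1 -bb mulrA ab mulN1r.
ring.
Qed.

Lemma bd_bd f A : bd (bd f) A = 0.
Proof.
pose F u w := if (u \notin A) && (w \notin u |: A) then
  pos_sign u A * (pos_sign w (u |: A) * f (w |: (u |: A))) else 0.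
transitivity (\sum_u \sum_w F u w).
  rewrite /bd big_mkcond; apply: eq_bigr => u _; rewrite /F.
  case: ifP => uA /=; last by rewrite big1.
  by rewrite mulr_sumr big_mkcond; apply: eq_bigr => w _.
apply: eq_opp_int0; rewrite {1}exchange_big -sumrN /=.
apply: eq_bigr => u _; rewrite -sumrN; apply: eq_bigr => w _; rewrite /F !inE.
have [->|uw] /= := eqVneq u w; first by rewrite ?eqxx andbF oppr0.
rewrite [_ && (u \notin A)]andbC.
case: ifP => [/andP[uA wA]|]; last by rewrite oppr0.
rewrite (pos_signU1 w uA) (pos_signU1 u wA) setUCA.
have := ltn_sign_anti uw; set a := _ ^+ _; set b := _ ^+ _ => ab.
have bb : b * b = 1 by rewrite -expr2 sqrr_sign.
have -> : a = - b by rewrite -[a]mulr1 -bb mulrA ab mulN1r.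
ring.
Qed.

End SetChains.

(** * The sign of an ordering *)

Section TupleChains.
Variable n : nat.
Local Notation V := 'I_n.
Implicit Types (A B : {set V}) (u v w : V) (s t : seq V).

(** The product of the signs of all differences: the sign of the permutation that
    sorts s, and 0 if s has a repetition. *)
Fixpoint order_sign s : int :=
  if s is v :: t then (\prod_(u <- t) sgz (u%:Z - v%:Z)) * order_sign t else 1.

Lemma sgz_prod I (r : seq I) (P : pred I) (F : I -> int) :
  sgz (\prod_(i <- r | P i) F i) = \prod_(i <- r | P i) sgz (F i).
Proof.
by elim/big_rec2: _ => [|i x y _ <-]; rewrite ?sgz1 ?sgzM.
Qed.

(** Identifying the sign with that of a Vandermonde determinant makes its
    behaviour under permutations a property of determinants. *)
Lemma order_sign_Vandermonde m (x : m.-tuple V) :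
  order_sign x = sgz (\det (Vandermonde m (\row_i (tnth x i : nat)%:Z))).
Proof.
rewrite det_Vandermonde sgz_prod.
under eq_bigr do rewrite sgz_prod.
elim: m x => [|m IH] x; first by rewrite tuple0 big_ord0.
case/tupleP: x => v x /=; rewrite big_ord_recl.
rewrite [X in _ = X * _]big_mkcond [X in _ = X * _]big_ord_recl /= mul1r.
congr (_ * _).
  rewrite big_tuple; apply: eq_bigr => i _.
  by rewrite !mxE tnth0 tnthS.
rewrite IH; apply: eq_bigr => i _; rewrite [RHS]big_mkcond big_ord_recl /= mul1r.
rewrite [LHS]big_mkcond; apply: eq_bigr => j _.
by rewrite !mxE !tnthS /bump /= !add1n ltnS.
Qed.

Lemma order_sign_permute m (p : 'S_m) (x : m.-tuple V) :
  order_sign (permute_tuple p x) = (-1) ^+ p * order_sign x.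
Proof.
rewrite !order_sign_Vandermonde.
set M := Vandermonde m _; set M' := Vandermonde m _.
have -> : M = M' *m perm_mx p^-1.
  rewrite -col_permE; apply/matrixP => i j; rewrite !mxE tnth_mktuple.
  by [].
rewrite det_mulmx det_perm odd_permV mulrC.
by case: (odd_perm p); rewrite ?expr1 ?mulN1r ?sgzN ?expr0 ?mul1r.
Qed.

Lemma order_sign_uniq s : ~~ uniq s -> order_sign s = 0.
Proof.
elim: s => //= v s IH; rewrite negb_and negbK => /orP[vs|/IH ->]; last by rewrite mulr0.
by rewrite (big_rem v) //= subrr sgz0 !mul0r.
Qed.

Lemma order_sign_sorted s : sorted ltn (map val s) -> order_sign s = 1.
Proof.
elim: s => //= v s IH /[dup] /path_sorted/IH ->.
rewrite (path_sortedE ltn_trans) mulr1 => /andP[/allP vs _].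
rewrite big_seq big1 // => u us.
by apply: gtr0_sgz; rewrite subr_gt0 ltz_nat vs // map_f.
Qed.

Lemma sorted_enum_ord A : sorted ltn (map val (enum A)).
Proof.
rewrite sorted_map /enum_mem -enumT; apply: sorted_filter.
  by move=> u v w; apply: ltn_trans.
by rewrite -(@sorted_map _ _ val ltn) (val_enum_ord n) iota_ltn_sorted.
Qed.

Lemma order_sign_cons v s : uniq s -> v \notin s ->
  order_sign (v :: s) = pos_sign v [set u in s] * order_sign s.
Proof.
move=> us vs /=; congr (_ * _); rewrite /pos_sign.
rewrite (eq_card (_ : _ =i filter (fun u : V => (u < v)%N) s)); last first.
  by move=> u; rewrite !inE mem_filter andbC.
rewrite (card_uniqP _) ?filter_uniq // size_filter.
elim: s us vs => [|u s IH] /=; first by rewrite big_nil.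
move=> /andP[_ us]; rewrite inE negb_or => /andP[vu vs].
rewrite big_cons IH // exprD; congr (_ * _).
case: ltngtP vu => [uv _|uv _|/val_inj ->]; last by rewrite eqxx.
  by rewrite ltr0_sgz // subr_lt0 ltz_nat.
by rewrite gtr0_sgz // subr_gt0 ltz_nat.
Qed.

Lemma order_sign_rem v s : v \in s -> uniq s ->
  order_sign s = (-1) ^+ index v s * order_sign (v :: rem v s).
Proof.
elim: s => //= y s IH; rewrite inE eq_sym; case: eqVneq => [-> _ _|yv /= vs].
  by rewrite mul1r.
case/andP=> ys us; rewrite IH //= (big_rem v vs) /= big_cons.
rewrite -[v%:Z - _]opprB sgzN exprS.
ring.
Qed.

End TupleChains.

(** * Alternating tuple functions versus functions on sets *)

Section Coefficients.
Variable n : nat.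
Local Notation V := 'I_n.
Implicit Types (A B : {set V}) (u v w : V) (s t : seq V) (f : {set V} -> int).

(** The coefficient of the increasingly ordered simplex on A. *)
Definition coef m (c : {ffun m.-tuple V -> int}) A : int :=
  oapp c 0 (insub (enum A)).

Lemma coef_enum m (c : {ffun m.-tuple V -> int}) A :
  #|A| = m -> exists2 t : m.-tuple V, t = enum A :> seq V & coef c A = c t.
Proof.
rewrite cardE => /eqP sA; exists (Tuple sA) => //.
by rewrite /coef insubT.
Qed.

Lemma coef_card m (c : {ffun m.-tuple V -> int}) A : coef c A != 0 -> #|A| = m.
Proof.
by rewrite /coef cardE; case: insubP => [t /eqP sA _ _|_]; rewrite ?eqxx.
Qed.

Lemma set_enum_tuple A : [set u in enum A] = A.
Proof. by apply/setP => u; rewrite inE mem_enum. Qed.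

Section Complex.
Variable K : complex V.

Lemma coef_supp m (c : chain K m) A : coef c A != 0 -> A \in simplices K.
Proof.
move=> cA; have [t tA] := coef_enum c (coef_card cA).
move=> E; rewrite E in cA; move/chain_supp: cA.
by rewrite (_ : [set v in t] = A) // -[RHS]set_enum_tuple -tA.
Qed.

(** An alternating function is determined by its values on increasing tuples. *)
Lemma chain_coef m (c : chain K m) (x : m.-tuple V) :
  c x = order_sign x * coef c [set v in x].
Proof.
have [ux|ux] := boolP (uniq x); last first.
  rewrite order_sign_uniq // mul0r; apply/eqP/negPn/negP => /chain_uniq.
  by rewrite (negbTE ux).
have cx : #|[set v in x]| = m by rewrite cardsE (card_uniqP ux) size_tuple.
have [t tE ->] := coef_enum c cx.
have /tuple_permP[p xE] : perm_eq x t.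
  by apply: uniq_perm => // [|u]; rewrite tE ?enum_uniq // mem_enum inE.
have -> : x = permute_tuple p t by apply/val_inj.
by rewrite chain_alt order_sign_permute (@order_sign_sorted _ t) ?mulr1 // tE sorted_enum_ord.
Qed.

Lemma coef_inj m (c d : chain K m) : coef c =1 coef d -> c = d.
Proof. by move=> cd; apply/val_inj/ffunP => x; rewrite /= !chain_coef cd. Qed.

Definition set_chain_fun m f : {ffun m.-tuple V -> int} :=
  [ffun x : m.-tuple V => order_sign x * f [set v in x]].

Lemma set_chain_subproof m f :
    (forall A, #|A| = m -> f A != 0 -> A \in simplices K) ->
  is_chain K (set_chain_fun m f).
Proof.
move=> fK; apply/is_chainP; split=> [x|p x]; rewrite !ffunE; last first.
  by rewrite order_sign_permute set_permute mulrA.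
have [ux|/order_sign_uniq->] := boolP (uniq x); last by rewrite mul0r eqxx.
rewrite mulf_eq0 negb_or => /andP[_]; apply: fK.
by rewrite cardsE (card_uniqP ux) size_tuple.
Qed.

Definition set_chain m f (fK : forall A, #|A| = m -> f A != 0 -> A \in simplices K) :
  chain K m := Chain (set_chain_subproof fK).

Lemma coef_set_chain m f A : #|A| = m -> coef (set_chain_fun m f) A = f A.
Proof.
move=> cA; have [t tE ->] := coef_enum (set_chain_fun m f) cA.
rewrite ffunE tE order_sign_sorted ?sorted_enum_ord // mul1r.
by congr f; rewrite -[RHS]set_enum_tuple -tE.
Qed.

(** Only for m > 0: the boundary of a 0-chain is zero by convention, whereas
    [bd] has an augmentation on the empty set. *)
Lemma coef_boundary m (c : chain K m.+1) A : (0 < m)%N ->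
  coef (boundary c) A = bd (coef c) A.
Proof.
move=> m0; have [cA|cA] := eqVneq #|A| m; last first.
  rewrite /bd big1 => [|v vA].
    by apply: contraNeq cA => /coef_card/eqP.
  apply/eqP/negPn/negP; rewrite mulf_eq0 negb_or => /andP[_ /coef_card/eqP].
  by rewrite cardsU1 vA add1n eqSS (negbTE cA).
have [t tE ->] := coef_enum (boundary c) cA.
have st : [set v in t] = A by rewrite -[RHS]set_enum_tuple -tE.
have mem_t v : (v \in tval t) = (v \in A) by rewrite tE mem_enum.
have ut : uniq t by rewrite tE enum_uniq.
rewrite ffunE st.
have -> : bd (coef c) A = \sum_(v : V) c [tuple of v :: t].
  rewrite /bd big_mkcond; apply: eq_bigr => v _.
  rewrite chain_coef; case: ifPn => vA; last first.
    by rewrite order_sign_uniq ?mul0r //= mem_t -(negbK (v \in A)) vA.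
  rewrite order_sign_cons ?mem_t //.
  rewrite order_sign_sorted ?mulr1; last by rewrite tE sorted_enum_ord.
  congr (_ * _); first by rewrite st.
  by congr coef; apply/setP => u; rewrite -st !inE.
case: ifPn => // AK; rewrite big1 // => v _.
apply: contraNeq AK => /chain_supp vK; apply: (simplex_sub vK).
  by apply/subsetP => u; rewrite -st !inE => ->; rewrite orbT.
by rewrite -card_gt0 cA.
Qed.

End Complex.

Section Equivariance.
Variable g : V -> V.
Hypothesis g_inj : injective g.

(** The tuple-level form of the statement that f' is the image of f under the
    vertex permutation g. Tuples, unlike sets with their increasing order, are
    carried by g without a sign. *)
Definition pushed f f' := forall s, uniq s ->
  order_sign (map g s) * f' [set u in map g s] = order_sign s * f [set u in s].

(** On tuples, multiplication by e_v deletes the entry v with the sign of its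
    position, a description that refers to no order on the vertices. It is what
    makes exterior multiplication equivariant. *)
Lemma order_sign_wedge v f s : uniq s ->
  order_sign s * wedge v f [set u in s] =
  if v \in s then
    (-1) ^+ index v s * (order_sign (rem v s) * f [set u in rem v s]) else 0.
Proof.
move=> us; rewrite /wedge inE; case: ifPn => vs; last by rewrite mulr0.
have -> : [set u in s] :\ v = [set u in rem v s].
  by apply/setP => u; rewrite !inE mem_rem_uniq // inE.
rewrite (order_sign_rem vs us) order_sign_cons ?rem_uniq ?mem_rem_uniq ?inE ?eqxx //.
rewrite -mulrA; congr (_ * _).
by rewrite [pos_sign _ _ * order_sign _]mulrC -mulrA pos_signK.
Qed.

Lemma map_rem v s : map g (rem v s) = rem (g v) (map g s).
Proof. by elim: s => //= u s IH; rewrite (inj_eq g_inj); case: ifP => //= _; rewrite IH. Qed.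

Lemma pushed_wedge v f f' : pushed f f' -> pushed (wedge v f) (wedge (g v) f').
Proof.
move=> ff' s us; rewrite !order_sign_wedge ?(map_inj_uniq g_inj) //.
rewrite (mem_map g_inj) index_map // -map_rem; case: ifP => // vs.
by rewrite ff' // rem_uniq.
Qed.

Lemma pushed_sum (I : finType) (F F' : I -> {set V} -> int) :
    (forall i, pushed (F i) (F' i)) ->
  pushed (fun A => \sum_i F i A) (fun A => \sum_i F' i A).
Proof.
by move=> FF' s us; rewrite !mulr_sumr; apply: eq_bigr => i _; apply: FF'.
Qed.

End Equivariance.
End Coefficients.

(** * The invariant cycle: powers of the sum of the e_v /\ e_(v+1) *)

Section Pairs.
Variable n : nat.
Local Notation V := 'I_n.
Implicit Types (A B : {set V}) (u v w : V) (f : {set V} -> int).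

(** Multiplication by the 2-form sum_v e_v /\ e_(v+1), with indices mod n. *)
Definition omega f A : int := \sum_v wedge v (wedge (ordS v) f) A.

(** The power omega^q: the base function is the unit of the exterior algebra,
    the empty simplex. For n > 2 q its support consists of the unions of q disjoint
    pairs of cyclic neighbours, which by Gale's evenness condition are the facets of
    a cyclic polytope of dimension 2 q with n vertices. *)
Definition cyclic_polytope q : {set V} -> int :=
  iter q omega (fun A => (A == set0)%:R).

Lemma wedge_neq0 v f A : wedge v f A != 0 -> v \in A /\ f (A :\ v) != 0.
Proof.
rewrite /wedge; case: ifP => [_|_]; last by rewrite eqxx.
by rewrite mulf_eq0 negb_or => /andP[].
Qed.

Lemma omega_neq0 f A : omega f A != 0 ->
  exists v, [/\ v \in A, ordS v \in A :\ v & f (A :\ v :\ ordS v) != 0].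
Proof.
move=> fA; have [v] : exists v, wedge v (wedge (ordS v) f) A != 0.
  apply: contrapT => H; case/negP: fA; rewrite /omega big1 // => v _.
  by apply/eqP/negPn/negP => vA; apply: H; exists v.
by case/wedge_neq0=> vA /wedge_neq0[]; exists v.
Qed.

(** The 2-form is closed because the boundaries e_(v+1) - e_v of its terms
    telescope around the cycle. *)
Lemma bd_omega f : bd (omega f) = omega (bd f).
Proof.
apply/funext => B; rewrite /bd /omega.
under eq_bigr do rewrite mulr_sumr.
rewrite exchange_big /=.
transitivity (\sum_v (wedge (ordS v) f B - wedge v f B
                      + wedge v (wedge (ordS v) (bd f)) B)).
  apply: eq_bigr => v _; rewrite -/(bd (wedge v (wedge (ordS v) f)) B).
  rewrite bd_wedge -addrA; congr (_ + _).
  have -> : bd (wedge (ordS v) f) = fun A => f A - wedge (ordS v) (bd f) A.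
    by apply/funext => A; rewrite bd_wedge.
  by rewrite /wedge; case: ifP => _; rewrite ?oppr0 ?addr0 // mulrBr opprB addrC.
rewrite big_split sumrB /= [X in _ - X](reindex_inj (@ordS_inj n)) /=.
by rewrite subrr add0r.
Qed.

Lemma bd_cyclic_polytope q B : bd (cyclic_polytope q) B = 0.
Proof.
rewrite /cyclic_polytope; elim: q B => [|q IH] B /=.
  rewrite /bd big1 // => v vB; rewrite (_ : _ == _ = false) ?mulr0 //.
  by apply/negbTE/set0Pn; exists v; rewrite setU11.
rewrite bd_omega /omega big1 // => v _; rewrite /wedge; case: ifP => // _.
by case: ifP; rewrite ?IH ?mulr0.
Qed.

Lemma cyclic_polytope_card q A : cyclic_polytope q A != 0 -> #|A| = q.*2.
Proof.
rewrite /cyclic_polytope; elim: q A => [|q IH] A /=.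
  by case: (eqVneq A set0) => [->|]; rewrite ?cards0 ?eqxx.
case/omega_neq0=> v [vA sA /IH cA].
by rewrite (cardsD1 v) vA (cardsD1 (ordS v)) sA cA.
Qed.

(** When v and v+1 do not wrap around, both elements of the pair jump over the same
    smaller elements, so the signs cancel. *)
Lemma wedge_pair v f A : v \in A -> ordS v \in A -> (v < ordS v)%N ->
  wedge v (wedge (ordS v) f) A = f (A :\ v :\ ordS v).
Proof.
move=> vA sA vs; rewrite /wedge vA.
have sA' : ordS v \in A :\ v by rewrite !inE sA andbT -val_eqE neq_ltn vs orbT.
rewrite sA' (pos_signD1 v sA') ltnNge ltnW // mul1r.
suff -> : pos_sign (ordS v) (A :\ v :\ ordS v) = pos_sign v (A :\ v :\ ordS v).
  by rewrite pos_signK.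
rewrite /pos_sign; congr (_ ^+ _); apply: eq_card => u; rewrite !inE.
case uA: (u \in A); last by rewrite !andbF.
case: (eqVneq u (ordS v)); case: (eqVneq u v) => //= uv us.
have vS : (v.+1 %% n = v.+1)%N.
  move: vs => /=; have := ltn_ord v; rewrite leq_eqVlt => /orP[/eqP E|lt _].
    by rewrite [X in (X %% _)%N]E modnn.
  by rewrite modn_small.
by move: uv; rewrite /= vS ltnS leq_eqVlt -val_eqE => /negbTE ->.
Qed.

Section AwayFromZero.
Variable v0 : V.
Hypothesis v0E : v0 = 0%N :> nat.

Lemma ltn_ordS v A : v0 \notin A -> ordS v \in A -> (v < ordS v)%N.
Proof.
move=> A0 sA; have : ordS v != v0 by apply: contraTneq sA => ->.
rewrite -val_eqE /= v0E.
have := ltn_ord v; rewrite leq_eqVlt => /orP[/eqP ->|lt]; first by rewrite modnn.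
by rewrite modn_small.
Qed.

Lemma omega_pair v f A : v0 \notin A ->
  wedge v (wedge (ordS v) f) A =
    if (v \in A) && (ordS v \in A) then f (A :\ v :\ ordS v) else 0.
Proof.
move=> A0; case: ifPn => [/andP[vA sA]|].
  by rewrite wedge_pair // (ltn_ordS A0).
apply: contraNeq => /wedge_neq0[vA /wedge_neq0[]].
by rewrite !inE vA => /andP[_ ->].
Qed.

(** Away from the vertex 0 no pair wraps around, and every sign is positive. *)
Lemma cyclic_polytope_ge0 q A : v0 \notin A -> 0 <= cyclic_polytope q A.
Proof.
rewrite /cyclic_polytope; elim: q A => [|q IH] A A0 /=; first by case: eqP.
rewrite /omega; apply: sumr_ge0 => v _; rewrite omega_pair //.
by case: ifP => // _; apply: IH; rewrite !inE (negbTE A0) !andbF.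
Qed.

Lemma cyclic_polytope_gt0 q A v : v0 \notin A -> v \in A -> ordS v \in A ->
  0 < cyclic_polytope q (A :\ v :\ ordS v) -> 0 < cyclic_polytope q.+1 A.
Proof.
move=> A0 vA sA gt0; rewrite /cyclic_polytope /= /omega (bigD1 v) //=.
rewrite omega_pair // vA sA; apply: ltr_wpDr => //.
apply: sumr_ge0 => u _; rewrite omega_pair //; case: ifP => // _.
by apply: cyclic_polytope_ge0; rewrite !inE (negbTE A0) !andbF.
Qed.

End AwayFromZero.

Section Symmetry.
Variable g : V -> V.
Hypothesis g_inj : injective g.

Lemma pushed_base :
  pushed g (fun A => (A == set0)%:R) (fun A => (A == set0)%:R).
Proof.
move=> s us; have nz (t : seq V) : ([set u in t] == set0) = (t == [::]).
  case: t => [|u t]; first by rewrite set_nil !eqxx.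
  by apply/negbTE/set0Pn; exists u; rewrite !inE eqxx.
by rewrite !nz; case: s us => //= u s _; rewrite !mulr0.
Qed.

Lemma pushed_rotation q : (forall v, g (ordS v) = ordS (g v)) ->
  pushed g (cyclic_polytope q) (cyclic_polytope q).
Proof.
move=> gS; rewrite /cyclic_polytope; elim: q => [|q IH] /=; first exact: pushed_base.
move=> s us; rewrite /omega [in LHS](reindex_inj g_inj) /=.
apply: (pushed_sum (F := fun v => wedge v (wedge (ordS v) _))
  (F' := fun v => wedge (g v) (wedge (ordS (g v)) _))) s us => v.
by rewrite -gS; do 2!apply: (pushed_wedge g_inj).
Qed.

(** A reflection exchanges the order of e_v and e_(v+1), whence one sign for each
    of the q factors. *)
Lemma pushed_reflection q : (forall v, ordS (g (ordS v)) = g v) ->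
  pushed g (cyclic_polytope q) (fun A => (-1) ^+ q * cyclic_polytope q A).
Proof.
move=> gS; rewrite /cyclic_polytope; elim: q => [|q IH] /=.
  by move=> s us; rewrite mul1r; apply: pushed_base.
move=> s us; rewrite /omega [in LHS](reindex_inj g_inj) /= .
rewrite [in LHS](reindex_inj (@ordS_inj n)) /=.
rewrite mulr_sumr.
apply: (pushed_sum (F := fun v => wedge v (wedge (ordS v) _))
  (F' := fun v A => (-1) ^+ q.+1 *
            wedge (g (ordS v)) (wedge (ordS (g (ordS v))) _) A)) s us => v.
move=> s us.
rewrite gS wedge_anti mulrN exprS mulN1r mulNr opprK.
have := pushed_wedge g_inj v (pushed_wedge g_inj (ordS v) IH) us.
rewrite /wedge => <-; congr (_ * _).
by case: ifP => _; [case: ifP => _|]; ring.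
Qed.

End Symmetry.
End Pairs.

(** * A cocycle on sorted sequences: cup powers of a coboundary *)

Section AlternatingSums.
Implicit Types (g : seq nat -> int) (s t : seq nat) (x y z : nat).

(** The alternating sum of g over the sequences obtained from s by deleting one
    entry, i.e. the coboundary of g at s. *)
Fixpoint alt_sum g s : int :=
  if s is x :: t then g t - alt_sum (fun t' => g (x :: t')) t else 0.

Lemma alt_sumZ (k : int) g s : alt_sum (fun t => k * g t) s = k * alt_sum g s.
Proof.
elim: s g => [|x s IH] g /=; first by rewrite mulr0.
by rewrite (IH (fun t => g (x :: t))) mulrBr.
Qed.

Lemma alt_sumE g s : uniq s ->
  alt_sum g s = \sum_(x <- s) (-1) ^+ index x s * g (rem x s).
Proof.
elim: s g => [|x s IH] g /=; first by rewrite big_nil.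
case/andP=> xs us; rewrite big_cons eqxx mul1r IH // -sumrN; congr (_ + _).
rewrite !big_seq; apply: eq_bigr => y ys.
have yx : x == y = false by apply: contraNF xs => /eqP->.
by rewrite yx exprS mulN1r mulNr.
Qed.

Variable m : nat.

Definition jump x y : int := (x + m <= y)%N%:R.

(** The coboundary of [jump], up to sign. On x < y < z it is 1 if z - x is at least
    m while both steps are shorter, and -1 if both steps are at least m. *)
Definition jump_cob x y z : int := jump x z - jump x y - jump y z.

(** The cup power of [jump_cob]: consecutive triples share an end point, so that
    sequences of even size get the value 0. *)
Fixpoint cup_power s : int :=
  if s is x :: (y :: t as t') then
    if t is z :: _ then jump_cob x y z * cup_power t else 0
  else (size s)%:R.

(** A cup power of a coboundary is a cocycle. The induction peels off one factor:
    the Leibniz rule leaves the coboundary of [jump_cob] at the first four entries,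
    which is zero identically in the values of [jump]. *)
Lemma alt_sum_cup_power s : alt_sum cup_power s = 0.
Proof.
have [k] := ubnP (size s); elim: k s => // k IH [|x [|y [|z [|w r]]]] // sk.
pose h t := cup_power (z :: t).
have IHz : cup_power (w :: r) - alt_sum h (w :: r) = 0.
  by apply: (IH (z :: w :: r)); move: sk => /=; lia.
have E : alt_sum h (w :: r) = cup_power (w :: r).
  by move/eqP: IHz; rewrite subr_eq0 => /eqP.
have -> : alt_sum cup_power [:: x, y, z, w & r] =
    jump_cob y z w * cup_power (w :: r) - (jump_cob x z w * cup_power (w :: r)
    - (jump_cob x y w * cup_power (w :: r)
       - alt_sum (fun t => jump_cob x y z * h t) (w :: r))) by [].
rewrite alt_sumZ E /jump_cob; ring.
Qed.


(** The sequence x, x + d, x + m, x + m + d, ..., x + q m, on which every factor of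
    the cup power equals 1. With d = m - 1 it supports the term of omega^q that
    shows the winding number to be positive; with d = 1 it is the unmatched set of
    the matching. *)
Fixpoint zigzag d x q :=
  if q is q'.+1 then [:: x, x + d & zigzag d (x + m) q']%N else [:: x].

Lemma zigzag_head d x q : zigzag d x q = x :: behead (zigzag d x q).
Proof. by case: q. Qed.

Lemma zigzag_bounds d x p y : (d < m)%N -> y \in zigzag d x p ->
  (x <= y <= x + p * m)%N.
Proof.
move=> dm; elim: p x => [|p IH] x /=; rewrite !inE; first by move/eqP->; lia.
case/or3P=> [/eqP->|/eqP->|/IH]; lia.
Qed.

Lemma zigzag_sorted d x p : (0 < d < m)%N -> sorted ltn (zigzag d x p).
Proof.
move=> dm; elim: p x => [|p IH] x //=.
by have := IH (x + m)%N; rewrite zigzag_head /= => ->; rewrite andbT; lia.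
Qed.

Lemma behead_zigzag_gt d x p y : (0 < d < m)%N -> y \in behead (zigzag d x p) ->
  (x < y)%N.
Proof.
move=> dm; have := @zigzag_sorted d x p dm; rewrite zigzag_head /=.
by rewrite (path_sortedE ltn_trans) => /andP[/allP H _] /H.
Qed.

Lemma cup_power_zigzag d x q : (0 < d < m)%N -> cup_power (zigzag d x q) = 1.
Proof.
move=> dm; elim: q x => // q IH x; rewrite [zigzag _ _ _]/= zigzag_head.
rewrite -[LHS]/(jump_cob x (x + d) (x + m) * cup_power (_ :: _)) -zigzag_head.
rewrite IH mulr1 /jump_cob /jump leqnn.
by case: leqP; case: leqP; rewrite ?subr0 //; lia.
Qed.

(** Each nonzero factor needs a span of at least m. A factor whose steps are not
    both shorter than m even needs 2 m, so that such a sequence has room for one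
    more factor. *)
Lemma cup_power_neq0 x s : sorted ltn (x :: s) -> cup_power (x :: s) != 0 ->
  (x + (size s)./2 * m <= last x s)%N /\
  (cup_power (x :: s) = 1 /\ sorted (fun y z => y < z < y + m)%N (x :: s) \/
   (x + ((size s)./2).+1 * m <= last x s)%N).
Proof.
have [k] := ubnP (size s); elim: k x s => // k IH x [|y [|z t]] //=.
  by move=> _ _ _; rewrite addn0; split=> //; left.
rewrite !ltnS => sk /and3P[xy yz zt].
rewrite -/(cup_power (z :: t)) mulf_eq0 negb_or => /andP[b0 /(IH _ _ (ltnW sk) zt)] [h1 h2].
rewrite !mulSn in h2 *; set a := ((size t)./2 * m)%N in h1 h2 *.
move: (last z t) h1 h2 => e h1 h2; move: b0; rewrite /jump_cob /jump.
case: (leqP (x + m) z) => xz; last first.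
  have [-> ->] : (x + m <= y)%N = false /\ (y + m <= z)%N = false.
    by clear -xy yz xz; lia.
  by [].
case: (leqP (x + m) y) => xmy; case: (leqP (y + m) z) => ymz // _.
  by split; [|right]; clear -xmy ymz h1; lia.
split; first by clear -xz h1; lia.
rewrite -/(cup_power (z :: t)); case: h2 => [[-> st]|h2]; last by right; clear -xz h2; lia.
by left; rewrite !subr0 mulr1 xy yz.
Qed.

End AlternatingSums.

Section Cochain.
Variable n : nat.
Local Notation V := 'I_n.
Implicit Types (A B : {set V}) (u v w : V) (f : {set V} -> int).

Definition nats A : seq nat := map val (enum A).

Lemma nats_sorted A : sorted ltn (nats A).
Proof. exact: sorted_enum_ord. Qed.

Lemma nats_uniq A : uniq (nats A).
Proof. by rewrite (map_inj_uniq val_inj) enum_uniq. Qed.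

Lemma mem_nats v A : (val v \in nats A) = (v \in A).
Proof. by rewrite (mem_map val_inj) mem_enum. Qed.

Lemma natsP A x : reflect (exists2 v, v \in A & x = val v) (x \in nats A).
Proof.
apply: (iffP mapP) => -[v vA ->]; exists v => //; first by rewrite mem_enum in vA.
by rewrite mem_enum.
Qed.

Lemma size_nats A : size (nats A) = #|A|.
Proof. by rewrite size_map cardE. Qed.

Lemma eq_nats A s : sorted ltn s -> nats A =i s -> nats A = s.
Proof. by apply: (irr_sorted_eq ltn_trans ltnn) (nats_sorted A). Qed.

Lemma nats_rem v A : v \in A -> nats (A :\ v) = rem (val v) (nats A).
Proof.
move=> vA; apply: eq_nats.
  by apply: subseq_sorted (nats_sorted A); [apply: ltn_trans | apply: rem_subseq].
move=> x; rewrite mem_rem_uniq ?nats_uniq // inE.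
apply/natsP/andP => [[u]|[xv /natsP[u uA xE]]].
  by rewrite !inE => /andP[uv uA] ->; rewrite mem_nats.
by exists u => //; rewrite !inE uA andbT -val_eqE -xE.
Qed.

Lemma index_sorted x s : sorted ltn s -> x \in s -> index x s = count (ltn^~ x) s.
Proof.
elim: s => //= y s IH yp; have := yp; rewrite (path_sortedE ltn_trans) => /andP[/allP ys _].
rewrite inE eq_sym; case: eqVneq => [<- _|yx /= xs].
  rewrite ltnn add0n; apply/esym/eqP; rewrite -leqn0 leqNgt -has_count.
  by apply/hasPn => z /ys; rewrite -leqNgt => /ltnW.
by rewrite ys // IH ?(path_sorted yp).
Qed.

Lemma pos_sign_index v A : v \in A -> pos_sign v (A :\ v) = (-1) ^+ index (val v) (nats A).
Proof.
move=> vA; rewrite index_sorted ?nats_sorted ?mem_nats //; congr (_ ^+ _).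
rewrite count_map -size_filter cardE; apply: perm_size; apply: uniq_perm.
- exact: enum_uniq.
- by rewrite filter_uniq ?enum_uniq.
move=> u; rewrite mem_enum !inE mem_filter mem_enum /= andbC.
by case: eqVneq => [->|]; rewrite ?ltnn.
Qed.

(** The adjoint of the boundary. *)
Lemma sum_bd (psi : {set V} -> int) f :
  \sum_B psi B * bd f B =
  \sum_A f A * \sum_(v in A) pos_sign v (A :\ v) * psi (A :\ v).
Proof.
transitivity (\sum_v \sum_(B : {set V} | v \notin B) psi B * (pos_sign v B * f (v |: B))).
  by rewrite (exchange_big_dep predT) //=; apply: eq_bigr => B _; rewrite mulr_sumr.
transitivity (\sum_v \sum_(A : {set V} | v \in A) f A * (pos_sign v (A :\ v) * psi (A :\ v))).
  apply: eq_bigr => v _.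
  rewrite (reindex_onto (fun A : {set V} => A :\ v) (fun B => v |: B)) /=; last first.
    by move=> B vB; rewrite setU1K.
  apply: eq_big => A.
    rewrite !inE eqxx /=; apply/eqP/idP => [<-|vA]; first by rewrite setU11.
    exact: setD1K.
  by case/andP=> _ /eqP ->; ring.
rewrite (exchange_big_dep predT) //=; apply: eq_bigr => B _.
by rewrite mulr_sumr.
Qed.

Lemma sum_cup_power_bd m f : \sum_B cup_power m (nats B) * bd f B = 0.
Proof.
rewrite (sum_bd (fun B => cup_power m (nats B))) big1 // => A _.
rewrite (_ : \sum_(v in A) _ = alt_sum (cup_power m) (nats A)).
  by rewrite alt_sum_cup_power mulr0.
rewrite alt_sumE ?nats_uniq // big_map big_enum /=; apply: eq_bigr => v vA.
by rewrite nats_rem // pos_sign_index.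
Qed.

End Cochain.

(** * The faces of the nerve, and the winding number *)

Section FaceCriterion.
Variables n k m : nat.
Hypotheses (nE : n = (k + m)%N) (m_gt1 : (1 < m)%N).
Local Notation V := 'I_n.
Implicit Types (A B : {set V}) (u v w i : V) (f : {set V} -> int).

Lemma mem_cyc_interval i v :
  (v \in cyc_interval n i (i + k)) = (i <= v <= i + k)%N || (v + n <= i + k)%N.
Proof.
have := ltn_ord i; have := ltn_ord v => vn i_n.
apply/cyc_intervalP/idP => [[a /andP[ia ai] va]|/orP[iv|vi]].
- have [an|an] := ltnP a n; first by rewrite va modn_small // ia ai.
  move: va; rewrite -(subnK an) modnDr modn_small; lia.
- by exists v; rewrite ?modn_small.
exists (v + n)%N; last by rewrite modnDr modn_small.
by rewrite vi andbT; lia.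
Qed.

Lemma gap_face A a : A != set0 -> (a + m <= n.+1)%N ->
  (forall u, u \in A -> ~~ (a <= u < a + m.-1)%N) -> A \in simplices (N n k).
Proof.
move=> A0 an gap; have n0 : (0 < n)%N by lia.
pose i := Ordinal (ltn_pmod (a + m.-1) n0); rewrite inE A0; apply/existsP; exists i.
apply/subsetP => u /gap; rewrite mem_cyc_interval /=; have := ltn_ord u.
have [lt|ge] := ltnP (a + m.-1) n; first by rewrite modn_small //; lia.
have -> : (a + m.-1 = n)%N by lia.
by rewrite modnn; lia.
Qed.

Lemma nonface_hit A a : A != set0 -> A \notin simplices (N n k) ->
  (a + m <= n.+1)%N -> exists2 u, u \in A & (a <= u < a + m.-1)%N.
Proof.
move=> A0 AN an; apply: contrapT => H; case/negP: AN.
apply: (gap_face A0 an) => u uA; apply/negP => au; apply: H.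
by exists u.
Qed.

(** A facet [i, i + k] omits the m - 1 vertices before i, so it omits v or v + 1
    only for the m values i = v + 1, ..., v + m mod n. *)
Lemma pair_nonfaces v :
  (#|[set i : V | ~~ ([set v; ordS v] \subset cyc_interval n i (i + k))]| <= m)%N.
Proof.
have n0 : (0 < n)%N by have := ltn_ord v; lia.
pose h (t : 'I_m) : V := Ordinal (ltn_pmod (v.+1 + t) n0).
have -> : m = #|'I_m| by rewrite card_ord.
apply: leq_trans (leq_imset_card h _); apply/subset_leq_card/subsetP => i.
rewrite inE; apply: contraR => ih; have := ltn_ord i; have vn := ltn_ord v => i_n.
have S : (ordS v = v.+1 :> nat) /\ (v.+1 < n)%N \/ (ordS v = 0%N :> nat) /\ v.+1 = n.
  move: vn; rewrite /= leq_eqVlt => /orP[/eqP E|lt]; [right|left].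
    by rewrite E modnn.
  by rewrite modn_small.
(* The exceptional values of i are v + 1 + t mod n with t < m. *)
have far t : (t < m)%N -> (v.+1 + t != i)%N && (v.+1 + t != i + n)%N.
  move=> tm; apply/andP; split; apply: contraNneq ih => E; apply/imsetP;
    exists (Ordinal tm) => //; apply/val_inj; rewrite /= E ?modnDr modn_small //.
apply/subsetP => u; rewrite mem_cyc_interval !inE => /orP[]/eqP->.
  have := far (i - v.+1)%N; have := far (i + n - v.+1)%N; lia.
have := far (i - v.+1)%N; have := far (i + n - v.+1)%N; lia.
Qed.

End FaceCriterion.

Section NerveFaces.
Variables n k m q : nat.
Hypotheses (nE : n = (k + m)%N) (m_gt1 : (1 < m)%N).
Hypotheses (lo : (q * m < n)%N) (hi : (n < q * m + m)%N).
Local Notation V := 'I_n.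
Implicit Types (A B : {set V}) (u v w i : V) (f : {set V} -> int).

(** The last entry below i is followed by an entry that is at least i, so its
    distance to i is less than m. *)
Lemma path_crossing x s i : path (fun y z => y < z < y + m)%N x s ->
  (x < i <= last x s)%N -> exists2 y, y \in x :: s & (y < i < y + m)%N.
Proof.
elim: s x => [|y s IH] x /=; first by lia.
case/andP=> xy ys xi; have [yi|iy] := ltnP y i.
  have [|z zs zi] := IH y ys; first by rewrite yi; case/andP: xi.
  by exists z => //; rewrite inE zs orbT.
by exists x; rewrite ?mem_head //; lia.
Qed.

Lemma cup_power_cases A : #|A| = q.*2.+1 -> cup_power m (nats A) != 0 ->
  exists x s, [/\ nats A = x :: s, (x + q * m <= last x s)%N, (last x s < n)%N,
    cup_power m (nats A) = 1 & path (fun y z => y < z < y + m)%N x s].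
Proof.
have := nats_sorted A; rewrite -size_nats.
case E: (nats A) => [|x s] // ps [sz] nz.
have [] := cup_power_neq0 ps nz; rewrite sz doubleK => h1 h2.
have lastn : (last x s < n)%N.
  have : last x s \in nats A by rewrite E mem_last.
  by case/natsP => u _ ->; apply: ltn_ord.
exists x, s; case: h2 => [[-> ?]|h2]; first by split.
by exfalso; move: h2 hi lastn; rewrite mulSn; clear; lia.
Qed.

(** A nonzero value forces all steps below m and a span of at least q m. The
    m - 1 vertices missed by a face can then lie neither between two entries, nor
    around the outside of the span, since n - q m < m. *)
Lemma cup_power_face A : #|A| = q.*2.+1 -> A \in simplices (N n k) ->
  cup_power m (nats A) = 0.
Proof.
move=> cA; rewrite inE => /andP[_ /existsP[i /subsetP Ai]].
apply/eqP/negPn/negP => /(cup_power_cases cA)[x [s [E span lastn _ ps]]].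
have inA (y : nat) : y \in x :: s -> (i <= y <= i + k)%N || (y + n <= i + k)%N.
  by rewrite -E => /natsP[u /Ai uA ->]; rewrite (mem_cyc_interval nE m_gt1) in uA.
have xi := inA x (mem_head _ _); have li := inA (last x s) (mem_last x s).
have [y ys yi] : exists2 y, y \in x :: s & (y < i < y + m)%N.
  by apply: path_crossing => //; have := ltn_ord i; lia.
by have := inA _ ys; have := ltn_ord i; lia.
Qed.

Lemma cup_power_ge0 A : #|A| = q.*2.+1 -> 0 <= cup_power m (nats A).
Proof.
move=> cA; have [->//|/(cup_power_cases cA)] := eqVneq (cup_power m (nats A)) 0.
by case=> x [s [_ _ _ ->]].
Qed.

(** Each of the q pairs excludes at most m facets, and q m < n. *)
Lemma cyclic_polytope_face A : cyclic_polytope q A != 0 -> A != set0 ->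
  A \in simplices (N n k).
Proof.
move=> Aq A0; suff H p B : cyclic_polytope p B != 0 ->
    (#|[set i : V | ~~ (B \subset cyc_interval n i (i + k))]| <= p * m)%N.
  rewrite inE A0; apply: contraT; rewrite negb_exists => /forallP all_i.
  have := H q A Aq; rewrite (_ : [set i : V | _] = setT) ?cardsT ?card_ord; first by lia.
  by apply/setP => i; rewrite !inE all_i.
rewrite /cyclic_polytope; elim: p B => [|p IH] B /=.
  case: (eqVneq B set0) => [-> _|]; rewrite ?eqxx //.
  by rewrite eq_card0 // => i; rewrite !inE sub0set.
case/omega_neq0=> v [vB sB /IH cB]; rewrite mulSn.
apply: leq_trans (leq_add (pair_nonfaces nE m_gt1 v) cB).
apply: leq_trans (leq_card_setU _ _); apply/subset_leq_card/subsetP => i.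
rewrite !inE -negb_and; apply: contra => /andP[/subsetP pi /subsetP Bi].
apply/subsetP => u uB; have [uv|uv] := eqVneq u v; first by apply: pi; rewrite uv !inE eqxx.
have [us|us] := eqVneq u (ordS v); first by apply: pi; rewrite us !inE eqxx orbT.
by apply: Bi; rewrite !inE uv us.
Qed.

Lemma cyclic_polytope_zigzag p x : (x + p * m < n)%N ->
  0 < cyclic_polytope p [set v : V | val v \in behead (zigzag m m.-1 x p)].
Proof.
have dm : (0 < m.-1 < m)%N by lia.
elim: p x => [|p IH] x xn.
  by rewrite /cyclic_polytope /= (_ : [set v | _] = set0) ?eqxx //;
    apply/setP => v; rewrite !inE.
have n0 : (0 < n)%N by lia.
have vn : (x + m.-1 < n)%N by lia.
pose v0 := Ordinal n0; pose v : V := Ordinal vn.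
have vS : val (ordS v) = (x + m)%N by rewrite /= modn_small; lia.
have BE y : (y \in behead (zigzag m m.-1 x p.+1)) =
    [|| y == x + m.-1, y == x + m | y \in behead (zigzag m m.-1 (x + m) p)]%N.
  by rewrite [zigzag _ _ _ _]/= /= inE zigzag_head inE.
have gt y : y \in behead (zigzag m m.-1 (x + m) p) -> (x + m < y)%N.
  exact: behead_zigzag_gt.
apply: (@cyclic_polytope_gt0 n v0 erefl p _ v).
- by rewrite inE BE /=; apply/or3P => -[/eqP|/eqP|/gt]; lia.
- by rewrite inE BE eqxx.
- by rewrite inE BE vS eqxx orbT.
suff -> : [set u : V | val u \in behead (zigzag m m.-1 x p.+1)] :\ v :\ ordS v =
    [set u : V | val u \in behead (zigzag m m.-1 (x + m) p)] by apply: IH; lia.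
apply/setP => u; rewrite !in_setD1 !in_set BE -!(inj_eq val_inj) vS.
apply/and3P/idP => [[us uv]|uB].
  by rewrite (negbTE us) (negbTE uv).
by rewrite uB !orbT; move: (gt _ uB); move: (val u) => y /= xy; split=> //; apply/eqP; lia.
Qed.

Section Functional.
Variable v0 : V.
Hypothesis v0E : v0 = 0%N :> nat.

(** Pairing the cocycle with the cone from v0. For cycles of the nerve this is the
    value on z of a cochain whose coboundary on the full simplex is the cocycle;
    for q = 1 it is, up to sign, the winding number around the circle. *)
Definition winding f : int := \sum_A cup_power m (nats A) * wedge v0 f A.

Lemma winding_polytope_gt0 : 0 < winding (cyclic_polytope q).
Proof.
have dm : (0 < m.-1 < m)%N by lia.
have term A : 0 <= cup_power m (nats A) * wedge v0 (cyclic_polytope q) A.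
  have [->|/wedge_neq0[A0 fA]] := eqVneq (wedge v0 (cyclic_polytope q) A) 0.
    by rewrite mulr0.
  apply: mulr_ge0.
    by apply: cup_power_ge0; rewrite (cardsD1 v0) A0 (cyclic_polytope_card fA).
  rewrite /wedge A0 /pos_sign (_ : [set u in _ | _] = set0); last first.
    by apply/setP => u; rewrite !inE v0E andbF.
  by rewrite cards0 mul1r (cyclic_polytope_ge0 v0E) // !inE eqxx.
(* The set 0, m - 1, m, 2 m - 1, 2 m, ..., q m without its apex 0. *)
pose T := [set v : V | val v \in behead (zigzag m m.-1 0 q)].
have T0 : v0 \notin T.
  by rewrite inE; apply/negP => /(behead_zigzag_gt dm); rewrite /= v0E.
rewrite /winding (bigD1 (v0 |: T)) //=; apply: ltr_wpDr; first by apply: sumr_ge0.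
rewrite /wedge setU11 setU1K // /pos_sign (_ : [set u in _ | _] = set0); last first.
  by apply/setP => u; rewrite !inE v0E andbF.
rewrite cards0 mul1r (_ : nats _ = zigzag m m.-1 0 q); last first.
  apply: eq_nats => [|y]; first exact: zigzag_sorted.
  rewrite zigzag_head inE; apply/natsP/orP => [[u]|].
    by rewrite !inE => /orP[/eqP-> ->|uT ->]; [left; rewrite /= v0E | right].
  case=> [/eqP->|yT]; first by exists v0; rewrite ?setU11 //= v0E.
  have yn : (y < n)%N.
    have : y \in zigzag m m.-1 0 q by rewrite zigzag_head inE yT orbT.
    by move/zigzag_bounds; lia.
  by exists (Ordinal yn) => //; rewrite !inE yT orbT.
by rewrite cup_power_zigzag // mul1r; apply: cyclic_polytope_zigzag; rewrite add0n.
Qed.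

(** By the homotopy formula the cone over the boundary of f is f minus a boundary;
    the cocycle vanishes on the faces carrying f and on boundaries. *)
Lemma winding_bd f : (forall A, f A != 0 -> #|A| = q.*2.+1) ->
  (forall A, f A != 0 -> A \in simplices (N n k)) -> winding (bd f) = 0.
Proof.
move=> fc fN; rewrite /winding.
transitivity (\sum_A (cup_power m (nats A) * f A - cup_power m (nats A) * bd (wedge v0 f) A)).
  by apply: eq_bigr => A _; rewrite -mulrBr bd_wedge opprB addrC subrK.
rewrite sumrB sum_cup_power_bd subr0 big1 // => A _.
have [->|fA] := eqVneq (f A) 0; first by rewrite mulr0.
by rewrite cup_power_face ?mul0r ?fc ?fN.
Qed.

End Functional.
End NerveFaces.

(** * A matching on the sets that are not faces *)

Section Matching.
Variables n k m : nat.
Hypotheses (nE : n = (k + m)%N) (m_gt1 : (1 < m)%N).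
Local Notation V := 'I_n.
Implicit Types (A B S T : {set V}) (u v w : V) (f : {set V} -> int).

Definition lowest S := head 0%N (nats S).

(** The i-th block of length m above the least element c of S should contain
    exactly its first two points, c + i m and c + i m + 1. *)
Definition good_block S i : bool :=
  all (fun t => (lowest S + i * m + t \in nats S)%N == (t < 2)%N) (iota 0 m).

(** Blocks beyond n are empty, hence bad, so that the search up to n succeeds. *)
Definition first_bad S := find (fun i => ~~ good_block S i) (iota 0 n.+1).

(** The vertex toggled by the matching: the second point of the first bad block.
    When it is not less than n the set is unmatched. *)
Definition pivot S := (lowest S + first_bad S * m).+1.

Definition nonface S := (S != set0) && (S \notin simplices (N n k)).

(** The lexicographic order on pairs (least element, first bad block), encoded as a
    number; the factor n + 2 exceeds every value of [first_bad]. *)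
Definition height S := (lowest S * n.+2 + first_bad S)%N.

Lemma nats_lt S x : x \in nats S -> (x < n)%N.
Proof. by case/natsP => u _ ->; apply: ltn_ord. Qed.

Lemma lowest_in S : S != set0 -> lowest S \in nats S.
Proof.
case/set0Pn => v; rewrite -mem_nats /lowest.
by case: (nats S) => //= a s _; rewrite mem_head.
Qed.

Lemma lowest_le S x : x \in nats S -> (lowest S <= x)%N.
Proof.
rewrite /lowest; have := nats_sorted S; case: (nats S) => //= a s.
rewrite (path_sortedE ltn_trans) inE => /andP[/allP as_ _] /orP[/eqP->//|/as_].
exact: ltnW.
Qed.

Lemma lowest_eq S x : x \in nats S -> (forall y, y \in nats S -> (x <= y)%N) ->
  lowest S = x.
Proof.
move=> xS xmin; apply/eqP; rewrite eqn_leq lowest_le //=; apply: xmin.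
by apply: lowest_in; case/natsP: xS => u uS _; apply/set0Pn; exists u.
Qed.

Lemma good_blockP S i : reflect
  (forall t, (t < m)%N -> (lowest S + i * m + t \in nats S)%N = (t < 2)%N)
  (good_block S i).
Proof.
apply: (iffP allP) => H t.
  by move=> tm; apply/eqP/H; rewrite mem_iota.
by rewrite mem_iota => /andP[_ tm]; apply/eqP/H.
Qed.

Lemma first_bad_le S : (first_bad S <= n)%N /\ ~~ good_block S (first_bad S).
Proof.
have H : has (fun i => ~~ good_block S i) (iota 0 n.+1).
  apply/hasP; exists n; first by rewrite mem_iota add0n leqnn.
  apply/negP => /good_blockP/(_ 0%N); rewrite addn0 => /(_ (ltnW m_gt1)) /nats_lt.
  by rewrite ltnNge (leq_trans _ (leq_addl _ _)) // leq_pmulr // ltnW.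
have := H; rewrite has_find size_iota ltnS => fn; split=> //.
by have := nth_find 0%N H; rewrite -/(first_bad S) nth_iota ?add0n.
Qed.

Lemma first_bad_good S j : (j < first_bad S)%N -> good_block S j.
Proof.
move=> jf; have := before_find 0%N jf; rewrite nth_iota; last first.
  by rewrite (leq_trans jf) // (leq_trans (first_bad_le S).1).
by move/negbFE.
Qed.

Lemma first_bad_ge S i : (forall j, (j < i)%N -> good_block S j) -> (i <= first_bad S)%N.
Proof.
move=> H; rewrite leqNgt; apply/negP => /H.
by apply/negP; case: (first_bad_le S).
Qed.

Lemma first_bad_unique S i : ~~ good_block S i -> (first_bad S <= i)%N.
Proof. by move=> bad; rewrite leqNgt; apply: contra bad => /first_bad_good. Qed.

Lemma block_position x c : (c <= x)%N ->
  exists j t, x = (c + j * m + t)%N /\ (t < m)%N.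
Proof.
move=> cx; exists ((x - c) %/ m)%N, ((x - c) %% m)%N.
by rewrite -addnA -divn_eq subnKC // ltn_pmod // ltnW.
Qed.

Lemma block_lt j t i : (j * m + t < i * m)%N -> (j < i)%N.
Proof.
move=> h; rewrite -(ltn_pmul2r (ltnW m_gt1)); apply: leq_ltn_trans h.
exact: leq_addr.
Qed.

Lemma block_le j i : (j < i)%N -> (j * m + m <= i * m)%N.
Proof. by move=> ji; rewrite addnC -mulSn leq_mul2r ji orbT. Qed.

(** The block before the first bad one ends with m - 2 missing points; without
    the first point of the bad block a whole run of m - 1 would be missing. *)
Lemma base_in S : nonface S -> (lowest S + first_bad S * m < n)%N ->
  (lowest S + first_bad S * m \in nats S)%N.
Proof.
case/andP=> S0 SN; set c := lowest S.
case: (posnP (first_bad S)) => [->|f0]; first by rewrite addn0 lowest_in.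
move=> lt; pose j := (first_bad S).-1.
have fE : (first_bad S * m = j * m + m)%N by rewrite -(prednK f0) mulSn addnC.
have /good_blockP good : good_block S j by apply: first_bad_good; rewrite /j; lia.
have [|u uS au] := nonface_hit nE m_gt1 (a := (c + j * m).+2) S0 SN; first by lia.
have [eq|ne] := eqVneq (val u) (c + first_bad S * m)%N; first by rewrite -eq mem_nats.
have := good (val u - (c + j * m))%N; rewrite subnKC; last by move: au => /=; lia.
rewrite mem_nats uS => H; have : (val u - (c + j * m) < 2)%N.
  by rewrite -H //; move: au ne => /=; lia.
by move: au => /=; lia.
Qed.

Lemma same_block S T i : lowest T = lowest S ->
    (forall x, (x < lowest S + i * m)%N -> (x \in nats T) = (x \in nats S)) ->
  forall j, (j < i)%N -> good_block T j = good_block S j.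
Proof.
move=> lE H j ji; rewrite /good_block lE; apply: eq_in_all => t.
rewrite mem_iota => /andP[_ tm]; rewrite H //; have := block_le ji; lia.
Qed.

Lemma height_lowest S T : (lowest S < lowest T)%N -> (height S < height T)%N.
Proof.
move=> lt; rewrite /height; have [fS _] := first_bad_le S.
(* One step of the least element outweighs any value of the first bad block. *)
apply: (@leq_trans ((lowest S).+1 * n.+2)); first by rewrite mulSn; lia.
by rewrite (leq_trans _ (leq_addr _ _)) // leq_mul2r lt orbT.
Qed.

Lemma mem_natsU1 u S x : (x \in nats (u |: S)) = (x == val u) || (x \in nats S).
Proof.
apply/natsP/orP => [[w]|[/eqP->|/natsP[w wS ->]]].
- by rewrite !inE => /orP[/eqP-> ->|wS ->]; [left | right; rewrite mem_nats].
- by exists u; rewrite ?setU11.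
by exists w; rewrite // inE wS orbT.
Qed.

Lemma mem_natsD1 u S x : (x \in nats (S :\ u)) = (x != val u) && (x \in nats S).
Proof.
apply/natsP/andP => [[w]|[xu /natsP[w wS xE]]].
  by rewrite !inE => /andP[wu wS] ->; rewrite mem_nats (inj_eq val_inj).
by exists w; rewrite // !inE wS -(inj_eq val_inj) -xE xu.
Qed.

(** Acyclicity of the matching upwards. After adding the pivot, removing an element
    below it other than the least one opens a gap of size m, which makes the set a
    face; removing the least element raises it; removing an element above the pivot
    keeps the blocks before it, so that either the result is matched downwards or
    its first bad block comes later. *)
Lemma height_up S T v u : nonface S -> nonface T ->
    val v = pivot S -> v \notin S -> u \in S -> T = (v |: S) :\ u ->
    pivot T \notin nats T ->
  (height S < height T)%N.
Proof.
move=> nS nT vE vS uS TE pT; have [S0 SN] := andP nS; have [T0 TN] := andP nT.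
have memT x : (x \in nats T) = (x != val u) && ((x == pivot S) || (x \in nats S)).
  by rewrite TE mem_natsD1 mem_natsU1 vE.
have un := ltn_ord u; have vn := ltn_ord v.
have vn' : (pivot S < n)%N by rewrite -vE.
have uv : val u != pivot S by rewrite -vE (inj_eq val_inj); apply: contraNneq vS => <-.
have lu : (lowest S <= val u)%N by rewrite lowest_le // mem_nats.
case: (eqVneq (val u) (lowest S)) => ul.
  apply: height_lowest; have := lowest_in T0; rewrite memT => /andP[lT].
  case/orP=> [/eqP->|/lowest_le]; first by rewrite /pivot; lia.
  by move: lT; rewrite ul; lia.
have lTS : lowest T = lowest S.
  apply: lowest_eq; first by rewrite memT eq_sym ul lowest_in ?orbT.
  move=> y; rewrite memT => /andP[_ /orP[/eqP->|]]; last exact: lowest_le.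
  by rewrite /pivot; lia.
case: (ltnP (pivot S) (val u)) => [vu|uv'].
  have same : forall j, (j < first_bad S)%N -> good_block T j = good_block S j.
    apply: same_block => // x xl; rewrite memT.
    have -> : (x != val u) by move: vu; rewrite /pivot; lia.
    by have -> : (x == pivot S) = false by rewrite /pivot; lia.
  have le : (first_bad S <= first_bad T)%N.
    by apply: first_bad_ge => j ji; rewrite same // first_bad_good.
  rewrite /height lTS ltn_add2l ltn_neqAle le andbT; apply: contraNneq pT => E.
  by rewrite /pivot lTS -E memT -/(pivot S) eq_sym uv eqxx.
have uv2 : (val u < pivot S)%N by rewrite ltn_neqAle uv uv'.
case/negP: TN.
have [j [t [uE tm]]] := block_position lu.
have empty_tail i t' : (i < first_bad S)%N -> (1 < t' < m)%N ->
    (lowest S + i * m + t' \notin nats T)%N.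
  move=> ib t2; have /good_blockP H := first_bad_good ib.
  rewrite memT negb_and negb_or H; last by lia.
  have := block_le ib; rewrite /pivot; lia.
have jt : (j < first_bad S)%N /\ (t < 2)%N \/ j = first_bad S /\ t = 0%N.
  have [jb|bj] := ltnP j (first_bad S).
    left; split=> //; have /good_blockP/(_ t tm) := first_bad_good jb.
    by rewrite -uE mem_nats uS.
  right; move: uv2; rewrite uE /pivot ltnS.
  have [jb|jb] := ltnP (first_bad S) j; first by have := block_le jb; lia.
  have -> : j = first_bad S by lia.
  lia.
case: (posnP t) => [t0|tpos].
  have j0 : (0 < j)%N by case: (posnP j) uE => // -> uE; move: ul; rewrite uE t0; lia.
  have jE : (j * m = j.-1 * m + m)%N by rewrite -{1}(prednK j0) mulSn addnC.
  have jb : (j.-1 < first_bad S)%N by lia.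
  (* Without its first point, block j extends the run of missing points
     that ends block j - 1. *)
  apply: (gap_face nE m_gt1 (a := (lowest S + j.-1 * m).+2) T0); first by lia.
  move=> w wT; apply/negP => wa; rewrite -mem_nats in wT.
  have [eq|ne] := eqVneq (val w) (val u); first by move: wT; rewrite memT eq eqxx.
  suff : val w \notin nats T by rewrite wT.
  rewrite -(@subnKC (lowest S + j.-1 * m) (val w)); last by move: wa => /=; lia.
  by apply: empty_tail => //; move: wa ne => /=; rewrite uE; lia.
have [jb t2] : (j < first_bad S)%N /\ t = 1%N by lia.
have jm := block_le jb.
(* Without its second point, block j ends with m - 1 missing points. *)
apply: (gap_face nE m_gt1 (a := (lowest S + j * m).+1) T0).
  by move: vn'; rewrite /pivot; lia.
move=> w wT; apply/negP => wa; rewrite -mem_nats in wT.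
have [eq|ne] := eqVneq (val w) (val u); first by move: wT; rewrite memT eq eqxx.
suff : val w \notin nats T by rewrite wT.
rewrite -(@subnKC (lowest S + j * m) (val w)); last by move: wa => /=; lia.
by apply: empty_tail => //; move: wa ne => /=; rewrite uE; lia.
Qed.

(** Acyclicity of the matching downwards. After deleting the pivot, an element
    added below the bad block lowers the least element or spoils an earlier block,
    and any other element leaves the bad block without its second point, so that
    the new set is matched upwards. *)
Lemma height_down S T v u : nonface S ->
    val v = pivot S -> v \in S -> u \notin S -> T = u |: (S :\ v) ->
    pivot T \in nats T ->
  (height T < height S)%N.
Proof.
move=> nS vE vS uS TE pT; have [S0 SN] := andP nS.
have memT x : (x \in nats T) = (x == val u) || (x != pivot S) && (x \in nats S).
  by rewrite TE mem_natsU1 mem_natsD1 vE.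
have uS' : val u \notin nats S by rewrite mem_nats.
have uv : pivot S != val u by rewrite -vE (inj_eq val_inj); apply: contraNneq uS => <-.
have lS := lowest_in S0; have lp : lowest S != pivot S by rewrite /pivot; lia.
have T0 : T != set0 by apply/set0Pn; exists u; rewrite TE setU11.
case: (ltngtP (val u) (lowest S)) => [ul|lu|ul]; last by rewrite ul lS in uS'.
  apply: height_lowest; apply: leq_ltn_trans ul; apply: lowest_le.
  by rewrite memT eqxx.
have lTS : lowest T = lowest S.
  apply: lowest_eq; first by rewrite memT lp lS orbT.
  by move=> y; rewrite memT => /orP[/eqP->|/andP[_ /lowest_le//]]; apply: ltnW.
rewrite /height lTS ltn_add2l.
have [j [t [uE tm]]] := block_position (ltnW lu).
have [jb|bj] := ltnP j (first_bad S).
  apply: leq_ltn_trans (jb); apply: first_bad_unique; apply/negP => /good_blockP/(_ t tm).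
  rewrite lTS -uE memT eqxx => /esym t2.
  have /good_blockP/(_ t tm) := first_bad_good jb.
  by rewrite -uE t2 (negbTE uS').
exfalso; have same : forall j, (j < first_bad S)%N -> good_block T j = good_block S j.
  apply: same_block => // x xl; rewrite memT.
  have -> : (x == val u) = false.
    by rewrite uE; have := leq_mul bj (leqnn m); lia.
  by have -> : (x != pivot S) by rewrite /pivot; lia.
have pN : pivot S \notin nats T by rewrite memT eqxx orbF.
have E : first_bad T = first_bad S.
  apply/eqP; rewrite eqn_leq; apply/andP; split.
    apply: first_bad_unique; apply/negP => /good_blockP/(_ 1%N m_gt1).
    by rewrite lTS addn1 -/(pivot S) (negbTE pN).
  by apply: first_bad_ge => i ib; rewrite same // first_bad_good.
by move: pT; rewrite /pivot lTS E -/(pivot S) (negbTE pN).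
Qed.

(** If deleting the pivot created a face, the missing run would have to start at the
    pivot, and the block of the pivot would be good. *)
Lemma nonface_pivot S v : nonface S -> val v = pivot S -> v \in S ->
  nonface (S :\ v).
Proof.
move=> nS vE vS; have [S0 SN] := andP nS; have vn := ltn_ord v.
have pn : (lowest S + first_bad S * m < n)%N by move: vn vE; rewrite /pivot /=; lia.
have /natsP[x xS xE] := base_in nS pn.
have xv : x != v by rewrite -(inj_eq val_inj) vE -xE /pivot neq_ltn ltnSn.
have xD : x \in S :\ v by rewrite !inE xv.
apply/andP; split; first by apply/set0Pn; exists x.
rewrite inE negb_and; apply/orP; right; apply/negP => /existsP[i /subsetP iS].
have vi : v \notin cyc_interval n i (i + k).
  apply: contra SN => vi; rewrite inE S0; apply/existsP; exists i.
  apply/subsetP => y yS; have [->//|yv] := eqVneq y v.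
  by apply: iS; rewrite !inE yv.
have := iS _ xD; move: vi; rewrite !(mem_cyc_interval nE m_gt1) // => vi xi.
have [_ /negP] := first_bad_le S; apply; apply/good_blockP => t tm; rewrite xE.
case: (ltnP t 2) => t2.
  have [->|->] : t = 0%N \/ t = 1%N by lia.
    by rewrite addn0 mem_nats.
  by rewrite addn1 -xE -/(pivot S) -vE mem_nats.
apply/negP => /natsP[y yS yE].
have yv : y != v by rewrite -(inj_eq val_inj) vE -yE /pivot xE; clear -t2; lia.
have := iS y; rewrite !inE yv yS => /(_ isT) yi.
have {}yi : y \in cyc_interval n i (i + k) by rewrite inE.
move: yi; rewrite (mem_cyc_interval nE m_gt1) //.
have := ltn_ord i; move: vi xi yE vE; rewrite /pivot xE /=.
by clear -nE tm t2; lia.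
Qed.

Lemma mem_zigzag d x p y : (y \in zigzag m d x p) <->
  (exists2 j, (j <= p)%N & y = (x + j * m)%N) \/
  (exists2 j, (j < p)%N & y = (x + j * m + d)%N).
Proof.
elim: p x y => [|p IH] x y /=.
  rewrite inE; split=> [/eqP->|[[j j0 ->]|[j]//]].
    by left; exists 0%N => //; rewrite addn0.
  by apply/eqP; move: j0; rewrite leqn0 => /eqP->; rewrite addn0.
rewrite !inE; split=> [/or3P[/eqP->|/eqP->|/IH[]]|].
- by left; exists 0%N => //; rewrite addn0.
- by right; exists 0%N => //; rewrite addn0.
- by case=> j jp ->; left; exists j.+1 => //; rewrite mulSn addnA.
- by case=> j jp ->; right; exists j.+1 => //; rewrite mulSn addnA.
case=> -[[|j] jp ->]; rewrite ?mul0n ?addn0 ?mulSn ?addnA ?eqxx ?orbT //.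
  by apply/or3P; apply: Or33; apply/IH; left; exists j.
by apply/or3P; apply: Or33; apply/IH; right; exists j.
Qed.

Lemma nats_zigzag S i : (forall j, (j < i)%N -> good_block S j) ->
    (lowest S + i * m \in nats S)%N ->
  nats S = zigzag m 1 (lowest S) i ++ [seq x <- nats S | (lowest S + i * m < x)%N].
Proof.
move=> good iS; have dm : (0 < 1 < m)%N by rewrite m_gt1.
apply: (irr_sorted_eq ltn_trans ltnn); first exact: nats_sorted.
  rewrite (sorted_pairwise ltn_trans) pairwise_cat -!(sorted_pairwise ltn_trans).
  rewrite (zigzag_sorted _ _ dm) sorted_filter ?nats_sorted ?andbT //; last exact: ltn_trans.
  apply/allrelP => y z /(zigzag_bounds m_gt1) /andP[_ yi].
  by rewrite mem_filter => /andP[/(leq_ltn_trans yi)].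
move=> y; rewrite mem_cat mem_filter.
have [iy|yi] := ltnP (lowest S + i * m)%N y.
  case: (boolP (y \in zigzag _ _ _ _)) => //= /(zigzag_bounds m_gt1); lia.
rewrite andFb orbF; apply/idP/idP => [yS|/mem_zigzag[[j ji ->]|[j ji ->]]]; last first.
- by have /good_blockP/(_ 1%N m_gt1) -> := good j ji.
- move: ji; rewrite leq_eqVlt => /orP[/eqP->//|ji].
  by have /good_blockP/(_ 0%N (ltnW m_gt1)) := good j ji; rewrite addn0.
apply/mem_zigzag; have [j [t [yE tm]]] := block_position (lowest_le yS).
move: yi; rewrite leq_eqVlt => /orP[/eqP->|yi]; first by left; exists i.
have ji : (j < i)%N by apply: (@block_lt j t); move: yi; rewrite yE; lia.
have /good_blockP/(_ t tm) := good j ji; rewrite -yE yS => /esym t2.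
have [t0|t1] : t = 0%N \/ t = 1%N by lia.
  by left; exists j; rewrite ?yE ?t0 ?addn0 // ltnW.
by right; exists j; rewrite // yE t1.
Qed.

Lemma cup_power_zigzag_cat d x p t : (0 < d < m)%N ->
  cup_power m (zigzag m d x p ++ t) = cup_power m ((x + p * m)%N :: t).
Proof.
move=> dm; elim: p x => [|p IH] x; first by rewrite /= addn0.
rewrite [zigzag _ _ _ _]/= zigzag_head !cat_cons.
rewrite -[LHS]/(jump_cob m x (x + d) (x + m) * cup_power m (_ :: _)) -cat_cons -zigzag_head.
rewrite IH mulSn addnA /jump_cob /jump leqnn.
by case: leqP; case: leqP; rewrite ?subr0 ?mul1r //; lia.
Qed.

Lemma size_zigzag d x p : size (zigzag m d x p) = p.*2.+1.
Proof. by elim: p x => //= p IH x; rewrite IH. Qed.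

(** On the good blocks the factors of the cup power are 1; the next factor sees
    the three smallest points of the bad block, which span less than m. *)
Lemma cup_power_down S : nonface S -> pivot S \in nats S ->
  cup_power m (nats S) = 0.
Proof.
move=> nS pS; have pn := nats_lt pS; have dm : (0 < 1 < m)%N by rewrite m_gt1.
have xS : (lowest S + first_bad S * m \in nats S)%N.
  by apply: base_in => //; apply: ltnW.
rewrite (nats_zigzag (@first_bad_good S) xS) cup_power_zigzag_cat //.
set x := (lowest S + _)%N in xS *; have pE : pivot S = x.+1 by [].
have [y yS xy] : exists2 y, y \in nats S & (x.+1 < y < x + m)%N.
  have [_] := first_bad_le S; rewrite /good_block -has_predC => /hasP[t].
  rewrite mem_iota -/x /= => tm; case: (ltnP t 2) => t2.
    have [->|->] : t = 0%N \/ t = 1%N by lia.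
      by rewrite addn0 xS.
    by rewrite addn1 -pE pS.
  by rewrite eqbF_neg negbK => tS; exists (x + t)%N => //; lia.
set r := filter _ _.
have yr : y \in r by rewrite mem_filter yS andbT; lia.
have pr : x.+1 \in r by rewrite mem_filter -pE pS ltnSn.
have sr : sorted ltn r by rewrite sorted_filter ?nats_sorted //; apply: ltn_trans.
have rx z : z \in r -> (x < z)%N by rewrite mem_filter => /andP[].
case: r rx yr pr sr => // y0 [|y1 r].
  by move=> _; rewrite !inE => /eqP <- /eqP; clear -xy; lia.
move=> rx yr pr sr; have xy0 := rx y0 (mem_head _ _); have y1x : (y1 < x + m)%N.
  move: sr yr pr => /=; rewrite (path_sortedE ltn_trans) => /and3P[y01 /allP yr1 _].
  rewrite !inE => /or3P[/eqP E|/eqP E|/yr1]; last by lia.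
    case/or3P=> [/eqP|/eqP|/yr1]; lia.
  by move=> _; lia.
rewrite -[LHS]/(jump_cob m x y0 y1 * cup_power m (y1 :: r)) /jump_cob /jump.
have y01 : (y0 < y1)%N by case/andP: sr.
have [-> [-> ->]] : (x + m <= y1)%N = false /\
    (x + m <= y0)%N = false /\ (y0 + m <= y1)%N = false.
  by clear -xy0 y01 y1x; lia.
by rewrite !subr0 mul0r.
Qed.

(** For an unmatched set the good blocks end exactly at n - 1, and the number of
    elements determines how many of them there are. Even numbers of elements,
    which arise when the last good block reaches n, are excluded by the size of S. *)
Lemma critical_unique q S : nonface S -> #|S| = q.*2.+1 -> (n <= pivot S)%N ->
  nats S = zigzag m 1 (n.-1 - q * m) q.
Proof.
move=> nS cS np; have [S0 _] := andP nS; have dm : (0 < 1 < m)%N by rewrite m_gt1.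
have := size_nats S; rewrite cS.
have [lt|ge] := ltnP (lowest S + first_bad S * m) n.
  have xS := base_in nS lt.
  rewrite {1 2}(nats_zigzag (@first_bad_good S) xS) (_ : filter _ _ = [::]); last first.
    apply/eqP; rewrite -[_ == _]negbK -has_filter; apply/hasPn => y /nats_lt.
    by move: np; rewrite /pivot; lia.
  rewrite cats0 size_zigzag => -[/double_inj E]; rewrite E; congr zigzag.
  by move: np lt; rewrite /pivot E; lia.
have f0 : (0 < first_bad S)%N.
  by case: (posnP (first_bad S)) ge (nats_lt (lowest_in S0)) => // ->; lia.
pose j := (first_bad S).-1.
have fE : (first_bad S * m = j * m + m)%N by rewrite -(prednK f0) mulSn addnC.
have jf : (j < first_bad S)%N by rewrite /j; lia.
have /good_blockP good := first_bad_good jf.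
have xS : (lowest S + j * m \in nats S)%N by have := good 0%N (ltnW m_gt1); rewrite addn0.
have gj i : (i < j)%N -> good_block S i.
  by move=> ij; apply: first_bad_good; apply: ltn_trans jf.
rewrite (nats_zigzag gj xS) (_ : filter _ _ = [:: (lowest S + j * m).+1]%N).
  by rewrite size_cat size_zigzag addn1 => -[]; lia.
apply: (irr_sorted_eq ltn_trans ltnn) => //.
  by rewrite sorted_filter ?nats_sorted //; apply: ltn_trans.
move=> y; rewrite mem_filter inE; apply/andP/eqP => [[jy yS]|->]; last first.
  by rewrite ltnSn -addn1 good.
have yn := nats_lt yS; have := good (y - (lowest S + j * m))%N.
rewrite subnKC ?yS; last exact: ltnW.
by move=> H; have := H; lia.
Qed.

End Matching.

(** * Cycles of winding number zero are boundaries *)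

Section Exactness.
Variables n k m q : nat.
Hypotheses (nE : n = (k + m)%N) (m_gt1 : (1 < m)%N).
Hypotheses (lo : (q * m < n)%N) (hi : (n < q * m + m)%N).
Local Notation V := 'I_n.
Implicit Types (A B S T : {set V}) (u v w : V) (f h e : {set V} -> int).
Variable v0 : V.

Definition matched_up S := [&& nonface k S, #|S| == q.*2.+1,
  (pivot m S < n)%N & pivot m S \notin nats S].

Definition pivot_ord S : V := insubd v0 (pivot m S).

Lemma val_pivot_ord S : (pivot m S < n)%N -> val (pivot_ord S) = pivot m S.
Proof. by move=> pn; rewrite val_insubd pn. Qed.

Lemma sum_supported (I : finType) (F : I -> int) (i : I) :
  (forall j, j != i -> F j = 0) -> \sum_j F j = F i.
Proof. by move=> H; rewrite (bigD1 i) //= big1 ?addr0. Qed.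

(** The only set matched upwards, of height at most that of S, in the boundary of
    the partner of S is S itself. *)
Lemma matched_up_face S T v : matched_up S -> matched_up T ->
    (height m T <= height m S)%N -> v \notin T ->
  (v |: T == pivot_ord S |: S) = (S == T) && (v == pivot_ord T).
Proof.
case/and4P=> nS /eqP cS pn pS /and4P[nT _ _ pT] hTS vT.
have pE := val_pivot_ord pn.
have pS' : pivot_ord S \notin S by rewrite -mem_nats pE.
apply/eqP/andP => [E|[/eqP<- /eqP->//]].
have [vp|vp] := eqVneq v (pivot_ord S).
  have ST : S = T by rewrite -(setU1K pS') -E vp setU1K // -vp.
  by rewrite -ST vp !eqxx.
have TE : T = (pivot_ord S |: S) :\ v by rewrite -E setU1K.
have vS : v \in S.
  have : v \in pivot_ord S |: S by rewrite -E setU11.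
  by rewrite !inE (negbTE vp).
have := height_up nE m_gt1 nS nT pE pS' vS TE pT.
by rewrite ltnNge hTS.
Qed.

(** Removing the coefficients in the order of increasing height: subtracting the
    boundary of the partner of S creates new coefficients, among the sets matched
    upwards, only at greater heights. *)
Lemma eliminate_matched_up h M : exists e,
  (forall E, e E != 0 -> #|E| = q.*2.+2) /\
  (forall S, matched_up S -> (height m S < M)%N -> h S = bd e S).
Proof.
elim: M => [|M [e [ec eh]]]; first by exists (fun=> 0); split=> // E; rewrite eqxx.
pose P S := matched_up S && (height m S == M).
pose a S := (h S - bd e S) * pos_sign (pivot_ord S) S.
pose e' E := \sum_(S | P S) a S * (E == pivot_ord S |: S)%:R.
exists (fun E => e E + e' E); split=> [E|T upT hT].
  have [->|/ec//] := eqVneq (e E) 0; rewrite add0r => nz.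
  apply: contraTeq nz => cE; rewrite negbK; apply/eqP/big1 => S.
  case/andP=> /and4P[_ /eqP cS pn pS] _.
  case: eqP => [EE|]; last by rewrite mulr0.
  move: cE; rewrite EE cardsU1 -mem_nats val_pivot_ord // pS cS add1n.
  by rewrite eqxx.
have -> : bd (fun E => e E + e' E) T = bd e T + bd e' T.
  by rewrite /bd -big_split; apply: eq_bigr => v _; rewrite mulrDr.
have -> : bd e' T = if height m T == M then h T - bd e T else 0; last first.
  case: ifP => [_|hT']; first by rewrite addrCA subrr addr0.
  by rewrite addr0 eh //; move: hT; rewrite ltnS leq_eqVlt hT'.
have inner S v : P S -> v \notin T ->
    (v |: T == pivot_ord S |: S) = (S == T) && (v == pivot_ord T).
  by case/andP=> upS /eqP hS; apply: matched_up_face => //; rewrite hS.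
have pT : pivot_ord T \notin T.
  by case/and4P: upT => _ _ pn; rewrite -mem_nats val_pivot_ord.
rewrite /bd.
transitivity (\sum_(v | v \notin T) \sum_(S | P S)
    (if (S == T) && (v == pivot_ord T) then pos_sign v T * a S else 0)).
  apply: eq_bigr => v vT; rewrite mulr_sumr; apply: eq_bigr => S PS.
  by rewrite inner //; case: ifP; rewrite ?mulr1 ?mulr0.
rewrite exchange_big /=.
case: ifP => hTM.
  have PT : P T by rewrite /P upT hTM.
  rewrite (bigD1 T) //= [X in _ + X]big1 ?addr0; last first.
    by move=> S /andP[_ /negbTE ST]; rewrite big1 // => v _; rewrite ST.
  rewrite (bigD1 (pivot_ord T)) //= !eqxx [X in _ + X]big1 ?addr0; last first.
    by move=> v /andP[_ /negbTE->].
  by rewrite /a mulrC -mulrA -expr2 sqrr_sign mulr1.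
rewrite big1 // => S /andP[_ hS]; rewrite big1 // => v _; case: eqVneq => //= ST.
by rewrite -ST hS in hTM.
Qed.

(** The chain b is the cone over f, freed of all sets that are not faces. Sets
    matched upwards are removed by a boundary. At the unmatched set the coefficient
    is the value of the cocycle on b, the cocycle being 0 on all other sets where b
    may be nonzero; this value is the winding number. At a set S matched downwards
    the coefficient is, up to sign, the coefficient of f at the partner of S,
    which is no face, as soon as all sets of smaller height are done. *)
Lemma winding_exact f : (forall A, f A != 0 -> #|A| = q.*2) ->
    (forall A, f A != 0 -> A \in simplices (N n k)) ->
    (forall B, bd f B = 0) -> winding m v0 f = 0 ->
  exists b, [/\ forall A, b A != 0 -> #|A| = q.*2.+1,
    forall A, b A != 0 -> A \in simplices (N n k) & forall B, bd b B = f B].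
Proof.
move=> fc fN f_cycle f_wind.
have [e [ec eh]] := eliminate_matched_up (wedge v0 f) (n.+1 * n.+2 + n.+1)%N.
pose b A := wedge v0 f A - bd e A.
have bc A : b A != 0 -> #|A| = q.*2.+1.
  have [fA|/wedge_neq0[A0 /fc cA] _] := eqVneq (wedge v0 f A) 0; last first.
    by rewrite (cardsD1 v0) A0 cA.
  rewrite /b fA sub0r oppr_eq0 => eA.
  have [v vA /ec] : exists2 v, v \notin A & e (v |: A) != 0.
    apply: contrapT => H; case/negP: eA; apply/eqP/big1 => v vA.
    by apply/eqP; rewrite mulf_eq0; apply/orP; right; apply/negPn/negP => ?; apply: H; exists v.
  by rewrite cardsU1 vA => -[].
have b_bd B : bd b B = f B.
  have -> : bd b B = bd (wedge v0 f) B - bd (bd e) B.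
    by rewrite /bd -sumrB; apply: eq_bigr => v _; rewrite -mulrBr.
  rewrite bd_bd subr0 bd_wedge /wedge f_cycle mulr0 if_same subr0 //.
have b_up S : matched_up S -> b S = 0.
  move=> upS; rewrite /b (eh S upS) ?subrr // /height.
  have [fS _] := first_bad_le m_gt1 S.
  have lS : (lowest S <= n)%N.
    rewrite /lowest; case E: (nats S) => [|x s] //=.
    by apply/ltnW/(@nats_lt n S); rewrite E mem_head.
  apply: (@leq_ltn_trans (n * n.+2 + n)); last by rewrite mulSn; lia.
  by rewrite leq_add // leq_mul2r lS orbT.
have b_wind : \sum_A cup_power m (nats A) * b A = 0.
  transitivity (winding m v0 f - \sum_A cup_power m (nats A) * bd e A).
    by rewrite /winding -sumrB; apply: eq_bigr => A _; rewrite mulrBr.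
  by rewrite f_wind sum_cup_power_bd subr0.
have b_zero_up S : nonface k S -> b S != 0 -> (pivot m S < n)%N -> pivot m S \in nats S.
  move=> nS bS pn; apply: contraT => pS.
  have cS := bc S bS; move: bS; rewrite b_up ?eqxx //.
  by rewrite /matched_up nS pn pS cS eqxx.
(* The cocycle is 1 at the unmatched set, and nothing else contributes. *)
have b_critical S : nonface k S -> (n <= pivot m S)%N -> b S = 0.
  move=> nS pn; apply/eqP/negPn/negP => bS.
  have cS := bc _ bS; have SE := critical_unique nE m_gt1 nS cS pn.
  have : \sum_A cup_power m (nats A) * b A = b S.
    rewrite (@sum_supported _ _ S).
      by rewrite SE cup_power_zigzag ?mul1r // m_gt1.
    move=> A AS; have [->|bA] := eqVneq (b A) 0; first by rewrite mulr0.
    have [AN|AN] := boolP (A \in simplices (N n k)).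
      by rewrite (cup_power_face nE m_gt1 lo hi (bc _ bA) AN) mul0r.
    have A0 : A != set0 by rewrite -card_gt0 bc.
    have nA : nonface k A by rewrite /nonface A0 AN.
    have [pA|pA] := ltnP (pivot m A) n.
      by rewrite (cup_power_down nE m_gt1 nA) ?mul0r // b_zero_up.
    have AE := critical_unique nE m_gt1 nA (bc _ bA) pA.
    case/eqP: AS; apply/setP => v; by rewrite -!mem_nats AE SE.
  by rewrite b_wind => /esym/eqP; rewrite (negbTE bS).
have b_nonface S : nonface k S -> b S = 0.
  have [M] := ubnP (height m S); elim: M S => // M IH S hM nS.
  have [pn|pn] := ltnP (pivot m S) n; last exact: b_critical.
  apply/eqP/negPn/negP => bS; have pS := b_zero_up S nS bS pn.
  have pE := val_pivot_ord pn; have vS : pivot_ord S \in S by rewrite -mem_nats pE.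
  have /andP[D0 DN] := nonface_pivot nE m_gt1 nS pE vS.
  have fD : f (S :\ pivot_ord S) = 0.
    by apply/eqP; apply: contraNT DN => /fN.
  have := b_bd (S :\ pivot_ord S); rewrite fD /bd (bigD1 (pivot_ord S)) /=; last first.
    by rewrite !inE eqxx.
  rewrite setD1K // big1 ?addr0 => [/eqP|u /andP[uD us]].
    by rewrite mulf_eq0 (negbTE bS) orbF /pos_sign signr_eq0.
  have uS : u \notin S by move: uD; rewrite !inE negb_and negbK (negbTE us).
  set T := u |: _; have nT : nonface k T.
    apply/andP; split; first by apply/set0Pn; exists u; rewrite setU11.
    by apply: contra DN => TN; apply: (simplex_sub TN) => //; apply: subsetUr.
  apply/eqP; rewrite mulf_eq0; apply/orP; right; apply/negPn/negP => bT.
  have [pTn|pTn] := ltnP (pivot m T) n; last by rewrite b_critical ?eqxx in bT.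
  have pT := b_zero_up T nT bT pTn.
  have hT : (height m T < height m S)%N by apply: (height_down nE m_gt1 nS pE vS uS).
  by rewrite IH ?eqxx // in bT; apply: leq_trans hT _.
exists b; split=> // A bA; apply: contraT => AN.
have A0 : A != set0 by rewrite -card_gt0 bc.
by rewrite b_nonface ?eqxx // /nonface A0 AN in bA.
Qed.

End Exactness.

(** * Homology and the dihedral action *)

(** A nonzero subgroup of the integers is generated by its least positive element;
    dividing by it turns an embedding into an isomorphism. *)
Lemma injective_int_iso (H : zmodType) (f : {additive H -> int}) (h0 : H) :
    injective f -> f h0 != 0 ->
  exists phi : {additive H -> int}, bijective phi.
Proof.
move=> f_inj f0.
(* The least positive value d of f divides all its values. *)
pose P d := `[< (0 < d)%N /\ exists h, f h = d%:Z >].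
have exP : exists d, P d.
  exists `|f h0|%N; apply/asboolP; split; first by rewrite absz_gt0.
  case: (ger0P (f h0)) => fh; [exists h0 | exists (- h0)]; rewrite ?raddfN /=.
    by rewrite gez0_abs.
  by rewrite ltz0_abs.
case: (ex_minnP exP) => d /asboolP[d0 [h1 fh1]] dmin.
have dz : d%:Z != 0 by rewrite eqz_nat -lt0n.
have fdiv h : f h = (f h %/ d%:Z)%Z * d%:Z.
  rewrite {1}(divz_eq (f h) d); apply/eqP; rewrite -subr_eq0 addrAC subrr add0r.
  apply: contraT => r0.
  have rE : f (h - h1 *~ (f h %/ d%:Z)%Z) = (f h %% d%:Z)%Z.
    rewrite raddfB /= raddfMz fh1 {1}(divz_eq (f h) d%:Z).
    by rewrite mulrzz mulrC addrAC subrr add0r.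
  have r_ge0 := modz_ge0 (f h) dz.
  have := dmin `|(f h %% d%:Z)%Z|%N; rewrite leqNgt.
  have -> : (`|(f h %% d%:Z)%Z| < d)%N by rewrite -ltz_nat gez0_abs // ltz_mod.
  move=> H1; suff : P `|(f h %% d%:Z)%Z|%N by move/H1.
  apply/asboolP; rewrite absz_gt0 r0; split=> //.
  by exists (h - h1 *~ (f h %/ d%:Z)%Z); rewrite rE gez0_abs.
pose phi h := (f h %/ d%:Z)%Z.
have phi_morph : zmod_morphism phi.
  by move=> x y; apply: (mulIf dz); rewrite mulrBl -!fdiv raddfB.
pose phiA : {additive H -> int} := HB.pack phi (GRing.isZmodMorphism.Build H int phi phi_morph).
exists phiA; exists (fun z => h1 *~ z) => [h|z] /=.
  by apply: f_inj; rewrite raddfMz fh1 mulrzz mulrC -fdiv.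
by apply: (mulIf dz); rewrite -fdiv raddfMz fh1 mulrzz mulrC.
Qed.

(** Every h satisfies f(h0) h = f(h) h0, and the group is torsion free. *)
Lemma rank1_endo (H : zmodType) (f : {additive H -> int})
    (G : {additive H -> H}) (h0 : H) (s : int) :
    injective f -> f h0 != 0 -> G h0 = h0 *~ s -> forall h, G h = h *~ s.
Proof.
move=> f_inj f0 Gh0 h.
have E : h *~ f h0 = h0 *~ f h.
  by apply: f_inj; rewrite !raddfMz !mulrzz mulrC.
have torsion (a b : H) : a *~ f h0 = b *~ f h0 -> a = b.
  move=> ab; apply: f_inj; apply: (mulIf f0).
  by have := congr1 f ab; rewrite !raddfMz !mulrzz.
by apply: torsion; rewrite -raddfMz E raddfMz Gh0 mulrzAC -E mulrzAC.
Qed.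

Section Homology.
Variables n k m l : nat.
Hypotheses (nE : n = (k + m)%N) (m_gt1 : (1 < m)%N).
Hypotheses (lo : (l.+1 * m < n)%N) (hi : (n < l.+1 * m + m)%N).
Local Notation V := 'I_n.
Local Notation p := (2 * l + 1)%N.
Local Notation H := (homology (N n k) p).
Variable v0 : V.
Hypothesis v0E : v0 = 0%N :> nat.

Lemma card_pairs : p.+1 = l.+1.*2.
Proof. by rewrite addn1 mul2n doubleS. Qed.

Lemma coefB j (c d : chain (N n k) j) A : coef (c - d) A = coef c A - coef d A.
Proof. by rewrite /coef; case: insub => [t|] /=; rewrite ?subr0 // !ffunE. Qed.

Lemma windingB (c d : chain (N n k) p.+1) :
  winding m v0 (coef (c - d)) = winding m v0 (coef c) - winding m v0 (coef d).
Proof.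
rewrite /winding -sumrB; apply: eq_bigr => A _; rewrite -mulrBr; congr (_ * _).
by rewrite /wedge; case: ifP => _; rewrite ?subr0 // coefB mulrBr.
Qed.

Lemma winding_boundary (b : chain (N n k) p.+2) : winding m v0 (coef (boundary b)) = 0.
Proof.
have -> : coef (boundary b) = bd (coef b) by apply/funext => A; rewrite coef_boundary.
apply: (winding_bd nE m_gt1 lo hi) => A bA; last exact: coef_supp bA.
by rewrite (coef_card bA) card_pairs.
Qed.

Definition winding_homology (h : H) : int :=
  winding m v0 (coef (cycle_val (generic_quotient.repr h))).

Lemma winding_homologyE (z : Defs.cycle (N n k) p) :
  winding_homology (\pi_(homology (N n k) p) z) = winding m v0 (coef (cycle_val z)).
Proof.
apply/eqP; rewrite -subr_eq0 -windingB.
have : generic_quotient.repr (\pi_(homology (N n k) p) z) - z \in @is_boundary _ (N n k) p.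
  by rewrite Quotient.idealrBE generic_quotient.reprK.
case/asboolP=> b bE; rewrite -(_ : boundary b = cycle_val _ - cycle_val _).
  by rewrite winding_boundary.
by rewrite bE.
Qed.

Lemma winding_homology_morph : zmod_morphism winding_homology.
Proof.
elim/generic_quotient.quotW=> x; elim/generic_quotient.quotW=> y.
by rewrite -raddfB !winding_homologyE windingB.
Qed.
HB.instance Definition _ :=
  GRing.isZmodMorphism.Build H int winding_homology winding_homology_morph.

(** Bundled explicitly: additivity depends on the numerical hypotheses, which the
    function does not mention. *)
Definition winding_additive : {additive H -> int} := winding_homology.

Lemma winding_homology_inj : injective winding_homology.
Proof.
elim/generic_quotient.quotW=> x; elim/generic_quotient.quotW=> y.
rewrite !winding_homologyE => /eqP; rewrite -subr_eq0 -windingB => /eqP xy.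
apply/eqP; rewrite -Quotient.idealrBE; set z := x - y in xy *.
have [||B|b [bc bN bz]] := winding_exact nE m_gt1 lo hi _ _ _ xy.
- by move=> A /coef_card ->; rewrite card_pairs.
- by move=> A /coef_supp.
- rewrite -coef_boundary ?addn1 //.
  have /eqP -> : boundary (cycle_val z) == 0 by exact: (valP z).
  by rewrite /coef; case: insub => //= t; rewrite ffunE.
apply/asboolP.
have bK (A : {set V}) : #|A| = p.+2 -> b A != 0 -> A \in simplices (N n k).
  by move=> _; apply: bN.
exists (set_chain bK); apply: coef_inj => A; rewrite coef_boundary // -bz.
rewrite /bd; apply: eq_bigr => v vA; congr (_ * _).
have [cA|cA] := eqVneq #|v |: A| p.+2; first by rewrite coef_set_chain.
have [->|/bc E] := eqVneq (b (v |: A)) 0; last by rewrite E -card_pairs eqxx in cA.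
by apply/eqP/negPn/negP => /coef_card/eqP; rewrite (negbTE cA).
Qed.

Lemma polytope_supp (A : {set V}) : #|A| = p.+1 -> cyclic_polytope l.+1 A != 0 ->
  A \in simplices (N n k).
Proof.
by move=> cA Aq; apply: (cyclic_polytope_face nE m_gt1 lo hi) => //; rewrite -card_gt0 cA.
Qed.

Definition polytope_chain : chain (N n k) p.+1 := set_chain polytope_supp.

Lemma coef_polytope_chain : coef polytope_chain = cyclic_polytope l.+1.
Proof.
apply/funext => A; have [cA|cA] := eqVneq #|A| p.+1; first exact: coef_set_chain.
transitivity (0 : int); apply/eqP.
  by apply/negPn/negP => /coef_card/eqP; rewrite (negbTE cA).
by rewrite eq_sym; apply/negPn/negP => /cyclic_polytope_card; rewrite -card_pairs; apply/eqP.
Qed.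

Fact polytope_is_cycle : is_cycle polytope_chain.
Proof.
apply/eqP/coef_inj => A; rewrite coef_boundary ?addn1 // coef_polytope_chain.
rewrite bd_cyclic_polytope /coef; case: insub => //= t.
by rewrite ffunE.
Qed.

Definition polytope_cycle : Defs.cycle (N n k) p := Cycle polytope_is_cycle.

Definition fundamental_class : H := (\pi_(homology (N n k) p) polytope_cycle).

Lemma winding_fundamental : winding_homology fundamental_class != 0.
Proof.
rewrite winding_homologyE /= coef_polytope_chain.
exact/lt0r_neq0/(winding_polytope_gt0 nE m_gt1 lo hi v0E).
Qed.

Lemma push_polytope (g : {perm V}) (s : int) (gN : simplicial_map (N n k) (N n k)) :
    gN =1 g -> s * s = 1 ->
    pushed g (cyclic_polytope l.+1) (fun A => s * cyclic_polytope l.+1 A) ->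
  forall y, push gN polytope_chain y = s * polytope_chain y.
Proof.
move=> gE ss gp y; rewrite ffunE.
pose x0 : p.+1.-tuple V := [tuple of map (g^-1)%g y].
have yE : y = [tuple of map g x0].
  by apply/val_inj; rewrite /= -map_comp map_id_in // => v _ /=; rewrite permKV.
rewrite (big_pred1 x0) => [|x] /=; last first.
  apply/eqP/eqP => [|->].
    move=> xy; apply/val_inj; rewrite /= -xy -map_comp map_id_in // => v _ /=.
    by rewrite gE permK.
  by rewrite [RHS]yE; apply/val_inj; rewrite /=; apply: eq_map.
rewrite !ffunE [in RHS]yE.
have [ux|ux] := boolP (uniq x0).
  rewrite -gp //; by rewrite mulrCA.
rewrite !order_sign_uniq ?mul0r ?mulr0 //=.
by rewrite (map_inj_uniq perm_inj).
Qed.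

Lemma dihedral_act_fundamental (x : [subg dihedral n]) (s : int) :
    (s = 1 \/ s = -1) ->
    pushed (sgval x) (cyclic_polytope l.+1) (fun A => s * cyclic_polytope l.+1 A) ->
  forall h : H, dihedral_act x h = h *~ s.
Proof.
move=> s1 gp; rewrite /dihedral_act.
apply: (@rank1_endo H winding_homology (homology_map (dihedral_map k x)) fundamental_class).
- exact: winding_homology_inj.
- exact: winding_fundamental.
rewrite -[LHS]/(homology_map (dihedral_map k x) (\pi_(homology (N n k) p) polytope_cycle)).
rewrite homology_mapE.
have pp : forall y, push (dihedral_map k x) polytope_chain y = s * polytope_chain y.
  apply: (@push_polytope (sgval x)) => //.
  by case: s1 => ->.
rewrite -raddfMz; congr (\pi_(homology (N n k) p) _); apply/val_inj/val_inj/ffunP => y.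
rewrite /= pp; case: s1 => ->; first by rewrite mul1r mulr1z.
by rewrite mulN1r mulrN1z /= [RHS]ffunE.
Qed.

End Homology.

Lemma pushed_rotation_perm n q :
  pushed (rot_perm n) (cyclic_polytope q) (fun A => 1 * cyclic_polytope q A).
Proof.
move=> s us; rewrite mul1r; apply: pushed_rotation us => [|v]; first exact: perm_inj.
by rewrite !permE.
Qed.

Lemma pushed_reflection_perm n q :
  pushed (refl_perm n) (cyclic_polytope q) (fun A => (-1) ^+ q * cyclic_polytope q A).
Proof.
apply: pushed_reflection => [|v]; first exact: perm_inj.
apply/val_inj; rewrite !permE /=; have := ltn_ord v.
rewrite leq_eqVlt => /orP[/eqP E|lt].
  rewrite {1}E modnn subn0 modnn; have -> : (n - v = 1)%N by lia.
  by [].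
rewrite [(v.+1 %% n)%N]modn_small // [((n - v.+1) %% n)%N]modn_small; last by lia.
by rewrite subnSK // ltnW.
Qed.

Theorem proposition7p3 (n k l : nat) (n_ge1 : (1 <= n)%N)
    (lb : l%:R / (l + 1)%:R < k%:R / n%:R :> rat)
    (ub : k%:R / n%:R < (l + 1)%:R / (l + 2)%:R :> rat) :
  (exists phi : {additive homology (N n k) (2 * l + 1) -> int}, bijective phi) /\
  (forall h : homology (N n k) (2 * l + 1),
     dihedral_act (dihedral_g n) h = h) /\
  (forall h : homology (N n k) (2 * l + 1),
     dihedral_act (dihedral_eps n) h = h *~ ((-1) ^+ (l + 1))).
Proof.
have pos j : (0 < j)%N -> 0 < j%:R :> rat by move=> j0; rewrite ltr0n.
have {}lb : (l * n < k * l.+1)%N.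
  move: lb; rewrite addn1 ltr_pdivrMr ?pos // mulrAC ltr_pdivlMr ?pos //.
  by rewrite -!natrM ltr_nat.
have {}ub : (k * l.+2 < l.+1 * n)%N.
  move: ub; rewrite addn1 addn2 ltr_pdivrMr ?pos // mulrAC ltr_pdivlMr ?pos //.
  by rewrite -!natrM ltr_nat.
pose m := (n - k)%N.
have kn : (k < n)%N by clear -ub; nia.
have nE : n = (k + m)%N by rewrite /m subnKC // ltnW.
have lo : (l.+1 * m < n)%N by clear -lb nE; nia.
have hi : (n < l.+1 * m + m)%N by clear -ub nE; nia.
have m_gt1 : (1 < m)%N by clear -lo hi; nia.
pose v0 : 'I_n := Ordinal n_ge1.
split; [|split].
- apply: (@injective_int_iso _ (winding_additive nE m_gt1 lo hi v0)
                             (fundamental_class nE m_gt1 lo hi)).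
    exact: (winding_homology_inj nE m_gt1 lo hi).
  exact: (winding_fundamental nE m_gt1 lo hi).
- move=> h; rewrite (dihedral_act_fundamental nE m_gt1 lo hi (v0 := v0) _ (s := 1)) //.
    by left.
  exact: pushed_rotation_perm.
move=> h; rewrite [X in _ ^+ X]addn1.
apply: (dihedral_act_fundamental nE m_gt1 lo hi (v0 := v0)) => //.
  by rewrite -signr_odd; case: odd; [right|left].
exact: pushed_reflection_perm.
Qed.
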